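(* Let $n\geq 1$, $\lambda>0$, and let $K\subset\mathbb{R}^{n+1}$ be a convex body. If $K$ is $\lambda$-concave, then $$(k-j)\frac{W_i(K)}{\lambda^{i}}+(i-k)\frac{W_j(K)}{\lambda^{j}}+(j-i)\frac{W_k(K)}{\lambda^{k}}\geq 0$$ for every triple of integers $(i,j,k)$ with $0\leq i<j<k\leq n+1$. Moreover, equality holds (for a given such triple) if and only if $K$ is a $\lambda$-sausage body.
   Context: A convex body is a compact convex set with non-empty interior; balls are closed. For $\lambda>0$, a convex body $K\subset\mathbb{R}^{n+1}$ is $\lambda$-concave if for every $p\in\partial K$ there is a ball $B_{1/\lambda,p}$ of radius $1/\lambda$ whose boundary passes through $p$ such that $B_{1/\lambda,p}\cap U(p)\subseteq K\cap U(p)$ for some open neighborhood $U(p)$ of $p$. A $\lambda$-sausage body is the convex hull of two (possibly coinciding) balls of radius $1/\lambda$. The quermassintegrals $W_i(K)$, $i=0,\dots,n+1$, are defined by the Steiner formula $\mathrm{Vol}_{n+1}(K+tB)=\sum_{i=0}^{n+1}\binom{n+1}{i}W_i(K)t^i$ for $t\geq 0$, where $B$ is the unit ball of $\mathbb{R}^{n+1}$ and $+$ is Minkowski addition. *)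

(* Defs.v *)
From HB Require Import structures.
From mathcomp Require Import all_boot all_order all_algebra.
From mathcomp Require Import all_classical all_reals all_analysis.
Set Implicit Arguments. Unset Strict Implicit. Unset Printing Implicit Defensive.
Import Order.TTheory GRing.Theory Num.Theory.
Import numFieldNormedType.Exports.
Local Open Scope classical_set_scope.
Local Open Scope ring_scope.

Section Defs.
Variables (R : realType) (m : nat).
Local Notation V := 'rV[R]_m.

Definition edot (u v : V) : R := \sum_(i < m) u 0 i * v 0 i.
Definition enorm (u : V) : R := Num.sqrt (edot u u).

Definition eball (c : V) (r : R) : set V := [set x | enorm (x - c) <= r].

Definition convex_set (C : set V) : Prop :=
  forall x y t, C x -> C y -> 0 <= t -> t <= 1 -> C ((1 - t) *: x + t *: y).

Definition convex_body (K : set V) : Prop :=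
  compact K /\ convex_set K /\ (K^° !=set0).

Definition conv_hull (A : set V) : set V :=
  [set x | forall C, convex_set C -> A `<=` C -> C x].

Definition minkowski_sum (A B : set V) : set V :=
  [set z | exists x y, A x /\ B y /\ z = x + y].

Definition scale_set (t : R) (A : set V) : set V := [set z | exists y, A y /\ z = t *: y].

Definition bdry (K : set V) : set V := closure K `\` K^°.

Definition lambda_concave (lam : R) (K : set V) : Prop :=
  forall p, bdry K p ->
    exists c : V, enorm (p - c) = lam^-1 /\
      exists U : set V, open U /\ U p /\ eball c lam^-1 `&` U `<=` K `&` U.

Definition lambda_sausage (lam : R) (K : set V) : Prop :=
  exists c1 c2 : V, K = conv_hull (eball c1 lam^-1 `|` eball c2 lam^-1).

Definition box (a b : V) : set V := [set x | forall i, a 0 i <= x 0 i <= b 0 i].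
Definition box_vol (a b : V) : R := \prod_(i < m) (b 0 i - a 0 i).
Definition vol (A : set V) : \bar R :=
  ereal_inf [set s | exists a b : nat -> V,
     (forall k i, a k 0 i <= b k 0 i) /\
     A `<=` \bigcup_k box (a k) (b k) /\
     s = (\sum_(0 <= k <oo) (box_vol (a k) (b k))%:E)%E].

End Defs.

(* W is the sequence of quermassintegrals of K (in R^(n+1)):
   Steiner formula  Vol(K + tB) = sum_{i=0}^{n+1} C(n+1,i) W_i t^i  for t >= 0 *)
Definition quermass (R : realType) (n : nat) (K : set 'rV[R]_(n.+1)) (W : nat -> R) : Prop :=
  forall t : R, 0 <= t ->
    vol (minkowski_sum K (scale_set t (eball 0 1))) =
    (\sum_(i < n.+2) ('C(n.+1, i))%:R * W i * t ^+ i)%:E.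

(* Main.v *)
(* Put r = 1/lam.  At every direction u <> 0 the function h_K - r|.|, where h_K
   is the support function of K, has a local linear minorant given by the centre
   of the ball attached to the point of K extreme in the direction u.  As the
   dimension is at least 2, segments can be moved off the origin and these local
   minorants are global; hence K = L + rB for a compact convex L, the set of
   centres of the balls of radius r contained in K.

   The Steiner polynomial of K gives a polynomial P with vol(L + sB) = P(s) for
   s >= r.  For any segment [-v, v], vol(M + s[-v, v]) is affine in s, so for a
   zonotope Z the polynomials vol(L + sZ) - vol(M + sZ), with M contained in L,
   are diagonals of nonnegative separately affine functions, and so have
   nonnegative coefficients.  Approximating B by zonotopes, the coefficients of
   P are nonnegative and monotone in L.  A parallelogram has a positive
   coefficient of degree n - 1, whereas a segment only has coefficients of degree
   n and n + 1; so the coefficient of degree n - 1 vanishes iff L is a segment,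
   i.e. iff K is a sausage body.

   With P(s) = sum_l C(n+1, l) w_l s^l one has
   W_i r^i = sum_l w_l r^l C(n+1-i, n+1-l).  The expression in the theorem is thus
   a combination of the w_l whose coefficients measure the convexity of
   x |-> C(x, n+1-l): they are nonnegative, zero for l >= n, and positive for
   l = n - 1. *)
Require Import Defs.
From HB Require Import structures.
From mathcomp Require Import all_boot all_order all_algebra.
From mathcomp Require Import all_classical all_reals all_analysis.
From mathcomp Require Import measurable_realfun ring lra zify.
Set Implicit Arguments. Unset Strict Implicit. Unset Printing Implicit Defensive.
Import Order.TTheory GRing.Theory Num.Theory.
Import numFieldNormedType.Exports.
(* MathComp-Analysis has another [convex_set], which hides that of [Defs]. *)
Import Defs.
Local Open Scope classical_set_scope.
Local Open Scope ring_scope.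

(** * Euclidean geometry of row vectors *)

Section Euclid.
Variables (R : realType) (m : nat).
Local Notation V := 'rV[R]_m.
Implicit Types u v w x y z : V.

Lemma edotC u v : edot u v = edot v u.
Proof. by apply: eq_bigr => i _; rewrite mulrC. Qed.

Lemma edotDl u v w : edot (u + v) w = edot u w + edot v w.
Proof. by rewrite -big_split; apply: eq_bigr => i _; rewrite mxE mulrDl. Qed.

Lemma edotZl a u v : edot (a *: u) v = a * edot u v.
Proof. by rewrite big_distrr; apply: eq_bigr => i _; rewrite mxE /= mulrA. Qed.

Lemma edotNl u v : edot (- u) v = - edot u v.
Proof. by rewrite -scaleN1r edotZl mulN1r. Qed.

Lemma edotDr u v w : edot w (u + v) = edot w u + edot w v.
Proof. by rewrite edotC edotDl !(edotC w). Qed.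

Lemma edotZr a u v : edot v (a *: u) = a * edot v u.
Proof. by rewrite edotC edotZl edotC. Qed.

Lemma edotNr u v : edot v (- u) = - edot v u.
Proof. by rewrite edotC edotNl edotC. Qed.

Lemma edot0l u : edot 0 u = 0.
Proof. by rewrite -(scale0r u) edotZl mul0r. Qed.

Lemma edot0r u : edot u 0 = 0.
Proof. by rewrite edotC edot0l. Qed.

Definition edotE := (edotDl, edotDr, edotNl, edotNr, edotZl, edotZr, edot0l, edot0r).

Lemma edot_ge0 u : 0 <= edot u u.
Proof. by apply: sumr_ge0 => i _; rewrite -expr2 sqr_ge0. Qed.

Lemma edot_eq0 u : (edot u u == 0) = (u == 0).
Proof.
apply/idP/eqP => [|->]; last by rewrite edot0l.
rewrite psumr_eq0 => [/allP u0|i _]; last by rewrite -expr2 sqr_ge0.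
apply/rowP => i; have := u0 i; rewrite mem_index_enum => /(_ isT).
by rewrite mxE mulf_eq0 orbb => /eqP.
Qed.

Lemma edot_gt0 u : (0 < edot u u) = (u != 0).
Proof. by rewrite lt_def edot_eq0 edot_ge0 andbT. Qed.

Lemma enorm_ge0 u : 0 <= enorm u.
Proof. exact: sqrtr_ge0. Qed.

Lemma sqr_enorm u : enorm u ^+ 2 = edot u u.
Proof. by rewrite sqr_sqrtr ?edot_ge0. Qed.

Lemma enorm_eq0 u : (enorm u == 0) = (u == 0).
Proof. by rewrite -(sqrf_eq0 (enorm u)) sqr_enorm edot_eq0. Qed.

Lemma enorm_gt0 u : (0 < enorm u) = (u != 0).
Proof. by rewrite lt_def enorm_eq0 enorm_ge0 andbT. Qed.

Lemma enorm0 : enorm (0 : V) = 0.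
Proof. by apply/eqP; rewrite enorm_eq0. Qed.

Lemma enormZ a u : enorm (a *: u) = `|a| * enorm u.
Proof. by rewrite /enorm edotZl edotZr mulrA -expr2 sqrtrM ?sqr_ge0// sqrtr_sqr. Qed.

Lemma enormN u : enorm (- u) = enorm u.
Proof. by rewrite -scaleN1r enormZ normrN1 mul1r. Qed.

Lemma enormB u v : enorm (u - v) = enorm (v - u).
Proof. by rewrite -enormN opprB. Qed.

Lemma enorm_le u v : (enorm u <= enorm v) = (edot u u <= edot v v).
Proof. by rewrite /enorm ler_sqrt ?edot_ge0. Qed.

Lemma cauchy_schwarz u v : edot u v <= enorm u * enorm v.
Proof.
have [->|v0] := eqVneq v 0; first by rewrite edot0r enorm0 mulr0.
have vp : 0 < edot v v by rewrite edot_gt0.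
apply: (le_trans (ler_norm _)).
rewrite -(@ler_pXn2r _ 2) ?nnegrE ?normr_ge0 ?mulr_ge0 ?enorm_ge0//.
rewrite real_normK ?num_real// exprMn !sqr_enorm.
have := edot_ge0 (edot v v *: u - edot u v *: v).
rewrite !edotE (edotC v u).
set a := edot u u; set b := edot u v; set c := edot v v => h.
have : 0 <= c * (a * c - b ^+ 2) by apply: le_trans h _; rewrite le_eqVlt; apply/orP; left; apply/eqP; ring.
by rewrite pmulr_rge0// subr_ge0.
Qed.

Lemma enormD u v : enorm (u + v) <= enorm u + enorm v.
Proof.
rewrite -(@ler_pXn2r _ 2) ?nnegrE ?addr_ge0 ?enorm_ge0//.
have := cauchy_schwarz u v.
rewrite sqrrD !sqr_enorm !edotE (edotC v u); lra.
Qed.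

Lemma coord_le_enorm u i : `|u 0 i| <= enorm u.
Proof.
rewrite -(@ler_pXn2r _ 2) ?nnegrE ?normr_ge0 ?enorm_ge0//.
rewrite sqr_enorm real_normK ?num_real// /edot (bigD1 i)//= expr2 lerDl.
by apply: sumr_ge0 => j _; rewrite -expr2 sqr_ge0.
Qed.

Lemma edot_continuous (v : V) : continuous (fun u : V => edot u v).
Proof.
apply: continuous_big => [|i _ u]; first exact: add_continuous.
exact: (cvgM (@coord_continuous R 1 m 0 i u) (cvg_cst _)).
Qed.

Lemma sqr_edot_continuous : continuous (fun u : V => edot u u).
Proof.
apply: continuous_big => [|i _ u]; first exact: add_continuous.
exact: (cvgM (@coord_continuous R 1 m 0 i u) (@coord_continuous R 1 m 0 i u)).
Qed.

Lemma enorm_continuous : continuous (@enorm R m).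
Proof.
move=> u; apply: (@continuous_comp _ _ _ (fun u : V => edot u u) Num.sqrt).
  exact: sqr_edot_continuous.
exact: sqrt_continuous.
Qed.

Lemma enormB_continuous c : continuous (fun x : V => enorm (x - c)).
Proof.
move=> x; apply: (@continuous_comp _ _ _ (fun x : V => x - c)); last exact: enorm_continuous.
by apply: continuousB; [exact: cvg_id|exact: cst_continuous].
Qed.

Lemma closed_eball c r : closed (eball c r : set V).
Proof.
have -> : eball c r = (fun x : V => enorm (x - c)) @^-1` [set x | x <= r] by [].
apply: closed_comp; last exact: closed_le.
by move=> x _; exact: enormB_continuous.
Qed.

Lemma eball_norm c r x : eball c r x -> `|x| <= enorm c + r.
Proof.
move=> xr; rewrite /Num.Def.normr /= mx_normrE; apply: bigmax_le => [|[i j] _ /=].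
  by rewrite addr_ge0 ?enorm_ge0// (le_trans _ xr)// enorm_ge0.
rewrite ord1 (le_trans (coord_le_enorm _ _))// -{1}(subrK c x) addrC.
by rewrite (le_trans (enormD _ _))// lerD2l.
Qed.

Lemma compact_eball c r : compact (eball c r : set V).
Proof.
apply: bounded_closed_compact; last exact: closed_eball.
exists (enorm c + r); split; first exact: num_real.
by move=> M Mr x /eball_norm /le_trans; apply; exact: ltW.
Qed.

Lemma convex_eball c r : convex_set (eball c r : set V).
Proof.
move=> x y t xr yr t0 t1; rewrite /eball /=.
have -> : (1 - t) *: x + t *: y - c = (1 - t) *: (x - c) + t *: (y - c).
  by apply/rowP => i; rewrite !mxE; ring.
rewrite (le_trans (enormD _ _))// !enormZ !ger0_norm ?subr_ge0//.
have -> : r = (1 - t) * r + t * r by ring.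
by rewrite lerD// ler_wpM2l ?subr_ge0.
Qed.

Lemma eball_center c r : 0 <= r -> eball c r (c : V).
Proof. by rewrite /eball /= subrr enorm0. Qed.

Lemma mink_compact (A B : set V) : compact A -> compact B -> compact (minkowski_sum A B).
Proof.
move=> cA cB.
have -> : minkowski_sum A B = (fun z : V * V => z.1 + z.2) @` (A `*` B).
  apply/seteqP; split => [z [x [y [Ax [By ->]]]]|z [[x y] [/= Ax By] <-]].
    by exists (x, y).
  by exists x, y.
apply: continuous_compact; last exact: compact_setX.
by apply: continuous_subspaceT => z; exact: add_continuous.
Qed.

Lemma mink_convex (A B : set V) : convex_set A -> convex_set B ->
  convex_set (minkowski_sum A B).
Proof.
move=> cA cB _ _ t [x [y [Ax [By ->]]]] [x' [y' [Ax' [By' ->]]]] t0 t1.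
exists ((1 - t) *: x + t *: x'), ((1 - t) *: y + t *: y'); split; first exact: cA.
by split; [exact: cB|rewrite !scalerDr addrACA].
Qed.

Lemma mink_sub (A A' B B' : set V) : A `<=` A' -> B `<=` B' ->
  minkowski_sum A B `<=` minkowski_sum A' B'.
Proof.
move=> AA BB _ [x [y [/AA Ax [/BB By ->]]]]; by exists x, y.
Qed.

Lemma minkA (A B C : set V) :
  minkowski_sum A (minkowski_sum B C) = minkowski_sum (minkowski_sum A B) C.
Proof.
apply/seteqP; split.
  move=> _ [x [_ [Ax [[y [z [By [Cz ->]]]] ->]]]].
  by exists (x + y), z; split; [exists x, y|split => //; rewrite addrA].
move=> _ [_ [z [[x [y [Ax [By ->]]]] [Cz ->]]]].
by exists x, (y + z); split => //; split; [exists y, z|rewrite addrA].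
Qed.

Lemma minkC (A B : set V) : minkowski_sum A B = minkowski_sum B A.
Proof.
by apply/seteqP; split=> _ [x [y [Ax [By ->]]]]; exists y, x; rewrite addrC.
Qed.

Lemma mink1 (A : set V) c : minkowski_sum [set c] A = +%R c @` A.
Proof.
apply/seteqP; split=> [_ [_ [y [-> [Ay ->]]]]|_ [y Ay <-]]; first by exists y.
by exists c, y.
Qed.

Lemma mink_eballD s t (c d : V) : 0 <= s -> 0 <= t ->
  minkowski_sum (eball c s) (eball d t) = eball (c + d) (s + t).
Proof.
move=> s0 t0; apply/seteqP; split.
  move=> _ [x [y [xs [yt ->]]]]; rewrite /eball /= opprD addrACA.
  by rewrite (le_trans (enormD _ _))// lerD.
move=> z; rewrite /eball /= => zst.
have [st0|st0] := eqVneq (s + t) 0.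
  exists c, d; split; first exact: eball_center.
  split; first exact: eball_center.
  move: zst; rewrite st0 le_eqVlt ltNge enorm_ge0 orbF enorm_eq0 subr_eq0.
  by move/eqP.
have stp : 0 < s + t by rewrite lt_def st0 addr_ge0.
have sc a : 0 <= a -> enorm ((a / (s + t)) *: (z - (c + d))) <= a.
  move=> a0; rewrite enormZ ger0_norm ?divr_ge0 ?(ltW stp)//.
  by rewrite mulrAC ler_pdivrMr// ler_wpM2l.
exists (c + (s / (s + t)) *: (z - (c + d))), (d + (t / (s + t)) *: (z - (c + d))).
split; first by rewrite /eball /= addrAC subrr add0r sc.
split; first by rewrite /eball /= addrAC subrr add0r sc.
by rewrite addrACA -scalerDl -mulrDl divff// scale1r addrC subrK.
Qed.

Lemma scale_eball t (r : R) : 0 <= t -> 0 <= r ->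
  scale_set t (eball (0 : V) r) = eball 0 (t * r).
Proof.
move=> t0 r0; apply/seteqP; split.
  move=> _ [y [yr ->]]; move: yr; rewrite /eball /= !subr0 enormZ ger0_norm//.
  by move=> ?; rewrite ler_wpM2l.
move=> z; rewrite /eball /= subr0 => zt.
have [t00|tn0] := eqVneq t 0.
  exists 0; split; first exact: eball_center.
  move: zt; rewrite t00 mul0r scale0r le_eqVlt ltNge enorm_ge0 orbF enorm_eq0.
  by move/eqP.
have tp : 0 < t by rewrite lt_def tn0.
exists (t^-1 *: z); split; last by rewrite scalerA divff// scale1r.
rewrite /= subr0 enormZ ger0_norm ?invr_ge0//.
by rewrite -(ler_pM2l tp) mulrA divff// mul1r.
Qed.

(** The direction from the point [p] of [A] nearest to [x] towards [x] separates: a point [z] of [A]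
    on the wrong side would give points between [p] and [z] closer to [x] than [p]. *)
Lemma separation (A : set V) x : compact A -> convex_set A -> A !=set0 -> ~ A x ->
  exists2 u, u != 0 & forall z, A z -> edot z u < edot x u.
Proof.
move=> cA vA A0 Ax.
have [|p /= Ap pmin] := @EVT_min_rV R m (fun z => enorm (z - x)) A A0 cA.
  by apply: continuous_subspaceT; exact: enormB_continuous.
rewrite inE in Ap.
have u0 : x - p != 0 by rewrite subr_eq0; apply/eqP => xp; apply: Ax; rewrite xp.
exists (x - p) => // z Az.
suff : edot (z - p) (x - p) <= 0.
  have : 0 < edot (x - p) (x - p) by rewrite edot_gt0.
  rewrite [X in 0 < X]edotDl [X in X <= 0]edotDl !edotNl; lra.
rewrite leNgt; apply/negP => zp.
have zpp : 0 < edot (z - p) (z - p).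
  rewrite edot_gt0; apply: contraTneq zp => ->; by rewrite edot0l ltxx.
have key t : 0 <= t -> t <= 1 -> 2 * edot (z - p) (x - p) <= t * edot (z - p) (z - p) \/ t = 0.
  move=> t0 t1; have [->|tn0] := eqVneq t 0; [by right|left].
  have tp : 0 < t by rewrite lt_def tn0.
  have /set_mem := mem_set (vA p z t Ap Az t0 t1).
  move=> /mem_set /pmin; rewrite !(enormB _ x) enorm_le.
  have -> : x - ((1 - t) *: p + t *: z) = (x - p) - t *: (z - p).
    by apply/rowP => i; rewrite !mxE; ring.
  move: (x - p) (z - p) => u q.
  rewrite !edotE (edotC u q) => h; rewrite -(ler_pM2l tp); lra.
pose e := edot (z - p) (x - p); pose d := edot (z - p) (z - p).
have e0 : 0 < e by []. have d0 : 0 < d by [].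
pose t := Num.min 1 (e / d).
have tp : 0 < t by rewrite lt_min ltr01 divr_gt0.
have [|h|t0] := key t (ltW tp); [by rewrite ge_min lexx| |by rewrite t0 ltxx in tp].
have : t * d <= e by rewrite -ler_pdivlMr// ge_min lexx orbT.
rewrite -/e -/d in h; lra.
Qed.
End Euclid.

(** * The outer measure [vol] *)

Section Volume.
Variables (R : realType) (n : nat).
Local Notation V := 'rV[R]_n.+1.
Local Open Scope ereal_scope.

Lemma box_vol_ge0 (a b : V) : (forall i, a 0%R i <= b 0%R i)%R -> (0 <= box_vol a b)%R.
Proof. by move=> ab; apply: prodr_ge0 => i _; rewrite subr_ge0. Qed.

Lemma box_series_ge0 (a b : nat -> V) : (forall k i, a k 0%R i <= b k 0%R i)%R ->
  0 <= \sum_(0 <= k <oo) (box_vol (a k) (b k))%:E.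
Proof. by move=> ab; apply: nneseries_ge0 => k _ _; rewrite lee_fin box_vol_ge0. Qed.

Lemma vol_le_cover (A : set V) (a b : nat -> V) :
  (forall k i, a k 0%R i <= b k 0%R i)%R -> A `<=` \bigcup_k box (a k) (b k) ->
  vol A <= \sum_(0 <= k <oo) (box_vol (a k) (b k))%:E.
Proof. by move=> ab Aab; apply: ereal_inf_lbound; exists a, b. Qed.

Lemma vol_ge0 (A : set V) : 0 <= vol A.
Proof.
by apply: le_ereal_inf_tmp => _ [a [b [ab [_ ->]]]]; exact: box_series_ge0.
Qed.

Lemma vol_le (A B : set V) : A `<=` B -> vol A <= vol B.
Proof.
move=> AB; apply: le_ereal_inf_tmp => _ [a [b [ab [Bab ->]]]].
by apply: vol_le_cover => //; exact: subset_trans Bab.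
Qed.

Lemma vol_box_le (a b : V) : (forall i, a 0%R i <= b 0%R i)%R ->
  vol (box a b) <= (box_vol a b)%:E.
Proof.
(* The box is followed by degenerate boxes, of volume zero because there is at least one
   coordinate. *)
move=> ab; pose c k := if k == 0%N then b else a.
have ac k i : (a 0%R i <= c k 0%R i)%R by rewrite /c; case: ifP.
apply: le_trans (@vol_le_cover _ (fun=> a) c ac _) _.
  by move=> x bx; exists 0%N.
rewrite nneseries_recl//=; last by move=> k _; rewrite lee_fin box_vol_ge0.
rewrite eseries_cond/= eseries0 ?adde0// => -[|k] //= _ _.
by rewrite /c /box_vol big_ord_recl subrr mul0r.
Qed.

Lemma vol_set0 : vol (set0 : set V) = 0.
Proof.
apply/eqP; rewrite eq_le vol_ge0 andbT.
apply: le_trans (vol_le (@sub0set _ (box 0%R 0%R))) _.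
by rewrite (le_trans (vol_box_le _))// /box_vol big_ord_recl subrr mul0r.
Qed.

Lemma vol_cover_lt (A : set V) (e : R) : vol A < +oo -> (0 < e)%R ->
  exists a b : nat -> V, [/\ (forall k i, a k 0%R i <= b k 0%R i)%R,
    A `<=` \bigcup_k box (a k) (b k) &
    \sum_(0 <= k <oo) (box_vol (a k) (b k))%:E <= vol A + e%:E].
Proof.
move=> Aoo e0; have Af : vol A \is a fin_num by rewrite ge0_fin_numE// vol_ge0.
have [_ [a [b [ab [Aab ->]]]] /ltW h] := lb_ereal_inf_adherent e0 Af.
by exists a, b.
Qed.

Lemma vol_sigma_subadditive : sigma_subadditive (@vol R n.+1).
Proof.
move=> A; have [[i ioo]|] := pselect (exists i, vol (A i) = +oo).
  by rewrite (eseries_pinfty _ _ ioo) ?leey// => k _; rewrite -ltNye (lt_le_trans _ (vol_ge0 _)).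
rewrite -forallNE => Aoo; apply/lee_addgt0Pr => e e0.
rewrite (le_trans _ (epsilon_trick _ _ (ltW e0)))//; last by move=> k; exact: vol_ge0.
pose P i (G : (nat -> V) * (nat -> V)) :=
  [/\ (forall k i, G.1 k 0%R i <= G.2 k 0%R i)%R,
    A i `<=` \bigcup_k box (G.1 k) (G.2 k) &
    \sum_(0 <= k <oo) (box_vol (G.1 k) (G.2 k))%:E <= vol (A i) + (e / (2 ^ i.+1)%:R)%:E].
have [G PG] : {G & forall i, P i (G i)}.
  apply: (@choice _ _ P) => i.
  have [||a [b [ab Aab h]]] := @vol_cover_lt (A i) (e / (2 ^ i.+1)%:R).
  - by rewrite ltey; apply/eqP; exact: Aoo.
  - by rewrite divr_gt0.
  by exists (a, b).
have /card_esym/ppcard_eqP[f] := card_nat2.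
pose F (ij : nat * nat) := (box_vol ((G ij.1).1 ij.2) ((G ij.1).2 ij.2))%:E.
have F0 ij : 0 <= F ij.
  by rewrite lee_fin box_vol_ge0// => i; have [+ _ _] := PG ij.1; exact.
apply: (le_trans (@vol_le_cover _ (fun k => (G (f k).1).1 (f k).2)
   (fun k => (G (f k).1).2 (f k).2) _ _)).
- by move=> k; have [+ _ _] := PG (f k).1; exact.
- move=> x [i _ Aix]; have [_ + _] := PG i; move=> /(_ _ Aix)[j _ xj].
  by exists (f^-1%FUN (i, j)) => //=; rewrite invK ?inE.
rewrite (nneseries_esumT (fun k => F0 (f k))).
rewrite -(@reindex_esum R _ _ setT setT f F); last by [].
have -> : [set: nat * nat] = setT `*`` (fun=> setT) by apply/seteqP; split.
rewrite -(@esum_esum R _ _ setT (fun=> setT) (fun i j => F (i, j)))//.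
rewrite nneseries_esumT; last first.
  by move=> i; rewrite adde_ge0 ?vol_ge0// lee_fin divr_ge0// ltW.
apply: le_esum => i _; rewrite -nneseries_esumT//.
by have [_ _] := PG i.
Qed.

HB.instance Definition _ := isOuterMeasure.Build R V (@vol R n.+1)
  vol_set0 vol_ge0 vol_le vol_sigma_subadditive.

Let upd (a : V) i (c : R) : V := \row_j (if j == i then c else a 0%R j).

(** A hyperplane orthogonal to a coordinate axis cuts each box of a cover into two boxes whose
    volumes add up to that of the box. *)
Let halfspace_caratheodory i c : (@vol R n.+1).-caratheodory [set x : V | x 0%R i <= c]%R.
Proof.
apply: le_caratheodory_measurable => X.
have [Xoo|] := ltP (vol X) +oo; last by move=> h; exact: le_trans (leey _) h.
apply/lee_addgt0Pr => e e0.
have [a [b [ab Xab /(le_trans _)->//]]] := vol_cover_lt Xoo e0.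
(* The cutting level is [c] clamped to the side of the box, so a box missed by the hyperplane splits
   into itself and a degenerate box. *)
pose m k := Num.max (a k 0%R i) (Num.min (b k 0%R i) c).
have am k : (a k 0%R i <= m k)%R by rewrite le_max lexx.
have mb k : (m k <= b k 0%R i)%R by rewrite ge_max ab ge_min lexx.
have ab1 k j : (a k 0%R j <= upd (b k) i (m k) 0%R j)%R.
  by rewrite mxE; case: eqP => [->|_].
have ab2 k j : (upd (a k) i (m k) 0%R j <= b k 0%R j)%R.
  by rewrite mxE; case: eqP => [->|_].
apply: (@le_trans _ _ (\sum_(0 <= k <oo) (box_vol (a k) (upd (b k) i (m k)))%:E
   + \sum_(0 <= k <oo) (box_vol (upd (a k) i (m k)) (b k))%:E)).
  apply: leeD; apply: vol_le_cover => // x [/Xab[k _ xk] /= xc]; exists k => // j; have := xk j.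
    rewrite mxE; case: eqP => [->|_//] /andP[-> xb] /=.
    by rewrite le_max le_min xb xc orbT.
  rewrite mxE; case: eqP => [->|_//] /andP[ax ->]; rewrite andbT.
  move/negP: xc; rewrite -ltNge => /ltW xc.
  by rewrite ge_max ax ge_min xc orbT.
rewrite -nneseriesD; try by move=> k _ _; rewrite lee_fin box_vol_ge0.
apply: lee_nneseries => k _; first by rewrite adde_ge0// lee_fin box_vol_ge0.
have D1 (u v : V) : box_vol u v = ((v 0 i - u 0 i) * \prod_(j < n.+1 | j != i) (v 0 j - u 0 j))%R.
  by rewrite /box_vol (bigD1 i).
rewrite -EFinD lee_fin !D1 !mxE eqxx.
rewrite (eq_bigr (fun j => b k 0 j - a k 0 j)%R); last by move=> j /negPf ji; rewrite mxE ji.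
rewrite [X in (_ + _ * X)%R](eq_bigr (fun j => b k 0 j - a k 0 j)%R); last first.
  by move=> j /negPf ji; rewrite mxE ji.
by rewrite -mulrDl addrC subrKA.
Qed.

Let hbox_caratheodory (a b : V) :
  (@vol R n.+1).-cara.-measurable [set x : V | forall i, (a 0 i < x 0 i <= b 0 i)%R].
Proof.
have -> : [set x : V | forall i, (a 0 i < x 0 i <= b 0 i)%R] =
  \bigcap_(i in [set: 'I_n.+1])
    (~` [set x : V | x 0 i <= a 0 i]%R `&` [set x : V | x 0 i <= b 0 i]%R).
  apply/seteqP; split => x /= xab i; have := xab i.
    by move=> /andP[xa xb] _; split => //=; apply/negP; rewrite -ltNge.
  by move=> /(_ I)[/negP]; rewrite -ltNge => -> ->.
apply: fin_bigcap_measurable => // i _; apply: measurableI; last exact: halfspace_caratheodory.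
by apply: measurableC; exact: halfspace_caratheodory.
Qed.

(** An open set is the union of the half-open boxes with rational corners that it contains, and
    these are countably many. *)
Lemma open_caratheodory (U : set V) : open U -> (@vol R n.+1).-cara.-measurable U.
Proof.
move=> oU; pose q2r (q : 'rV[rat]_n.+1) : V := \row_i ratr (q 0%R i).
pose D (q : 'rV[rat]_n.+1 * 'rV[rat]_n.+1) :=
  [set x : V | forall i, (q2r q.1 0 i < x 0 i <= q2r q.2 0 i)%R].
have -> : U = \bigcup_q (if pselect (D q `<=` U) then D q else set0).
  apply/seteqP; split => x; last by move=> [q _]; case: pselect => // h; exact: h.
  move=> Ux; have [e /= e0 eU] := (nbhs_ballP x U).1 (open_nbhs_nbhs (conj oU Ux)).
  have lt1 i : {q : rat | (x 0 i - e < ratr q < x 0 i)%R}.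
    by apply/cid; have [|q] := @rat_in_itvoo R (x 0 i - e)%R (x 0 i)%R; [lra|rewrite in_itv/=; exists q].
  have lt2 i : {q : rat | (x 0 i < ratr q < x 0 i + e)%R}.
    by apply/cid; have [|q] := @rat_in_itvoo R (x 0 i)%R (x 0 i + e)%R; [lra|rewrite in_itv/=; exists q].
  exists (\row_i projT1 (lt1 i), \row_i projT1 (lt2 i)) => //.
  have xD : D (\row_i projT1 (lt1 i), \row_i projT1 (lt2 i)) x.
    move=> i; rewrite !mxE /=; case: (lt1 i) => q /= /andP[_ ->] /=.
    by case: (lt2 i) => q' /= /andP[/ltW ->].
  case: pselect => //; apply; move=> y yD; apply: eU; split => // i j.
  rewrite ord1; have := yD j; rewrite !mxE /=.
  case: (lt1 j) => q /= /andP[h1 h2]; case: (lt2 j) => q' /= /andP[h3 h4] /andP[h5 h6].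
  rewrite /ball /= ltr_norml; lra.
apply: countable_bigcupT_measurable => [|q]; first exact: countableP.
by case: pselect => h; [exact: hbox_caratheodory|exact: measurable0].
Qed.

Lemma vol_split (M A : set V) : closed M -> vol A = vol (A `&` M) + vol (A `\` M).
Proof.
move=> cM; have /measurableC := open_caratheodory (closed_openC cM).
by rewrite setCK => /(_ A).
Qed.

Lemma vol_homothety (c : V) (s : R) (A : set V) : (0 < s)%R ->
  vol ((fun x => c + s *: x)%R @` A) = (s ^+ n.+1)%:E * vol A.
Proof.
move=> s0.
have le (d : V) (t : R) (B : set V) : (0 < t)%R -> vol ((fun x => d + t *: x)%R @` B) <= (t ^+ n.+1)%:E * vol B.
  move=> t0; have tn0 : (0 < t ^+ n.+1)%R by rewrite exprn_gt0.
  have [Boo|Boo] := ltP (vol B) +oo; last first.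
    by rewrite (le_trans (leey _))// -(gt0_muley (x := (t ^+ n.+1)%:E))// lee_pmul2l.
  apply/lee_addgt0Pr => e e0.
  have et : (0 < e / t ^+ n.+1)%R by rewrite divr_gt0.
  have [a [b [ab Bab h]]] := vol_cover_lt Boo et.
  apply: le_trans (@vol_le_cover _ (fun k => d + t *: a k)%R (fun k => d + t *: b k)%R _ _) _.
  - by move=> k i; rewrite !mxE lerD2l ler_pM2l.
  - move=> _ [x /Bab[k _ xk] <-]; exists k => // i.
    by rewrite !mxE !lerD2l !ler_pM2l.
  have E k : (box_vol (d + t *: a k) (d + t *: b k))%:E =
      (t ^+ n.+1)%:E * (box_vol (a k) (b k))%:E.
    rewrite -EFinM; congr EFin.
    have -> : (t ^+ n.+1 = \prod_(i < n.+1) t)%R by rewrite prodr_const card_ord.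
    rewrite /box_vol -big_split /=.
    by apply: eq_bigr => i _; rewrite !mxE; ring.
  rewrite (eq_eseriesr (fun k _ => E k)).
  rewrite nneseriesZl; last by move=> k _; rewrite lee_fin box_vol_ge0.
  have -> : (t ^+ n.+1)%:E * vol B + e%:E = (t ^+ n.+1)%:E * (vol B + (e / t ^+ n.+1)%:E).
    rewrite muleDr//; last by rewrite ge0_adde_def// inE ?vol_ge0// lee_fin ltW.
    by rewrite -EFinM mulrC divfK// gt_eqF.
  by rewrite lee_pmul2l.
apply/eqP; rewrite eq_le le//=.
have si0 : (0 < s^-1)%R by rewrite invr_gt0.
have := le (- s^-1 *: c)%R s^-1%R ((fun x => c + s *: x)%R @` A) si0.
rewrite image_comp (_ : _ \o _ = id) ?image_id; last first.
  apply/funext => x /=; rewrite scalerDr scalerA mulVf ?gt_eqF// scale1r.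
  by rewrite scaleNr addrA addNr add0r.
move=> h; rewrite -(@lee_pmul2l _ (s^-1 ^+ n.+1)%:E)//; last by rewrite lte_fin exprn_gt0.
by rewrite muleA -EFinM -exprMn mulVf ?gt_eqF// expr1n mul1e.
Qed.

End Volume.

(** * A lower bound for the volume of the unit cube *)

Section CubeVolume.
Variable R : realType.
Local Open Scope ereal_scope.

(* Integrating the coordinates one at a time; the weights [w] absorb the
   side lengths of the coordinates already integrated. *)
Lemma cube_cover (p : nat) (w : nat -> R) (a b : nat -> 'I_p -> R) :
  (forall k, 0 <= w k)%R -> (forall k i, a k i <= b k i)%R ->
  (forall x : 'I_p -> R, (forall i, 0 <= x i <= 1)%R ->
    1 <= \sum_(0 <= k <oo) (w k * \prod_(i < p) \1_(`[a k i, b k i]%classic) (x i))%:E) ->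
  1 <= \sum_(0 <= k <oo) (w k * \prod_(i < p) (b k i - a k i))%:E.
Proof.
elim: p w a b => [|p IH] w a b w0 ab h.
  have := h (fun=> 0%R); under eq_eseriesr do rewrite big_ord0.
  by under [in X in _ -> X]eq_eseriesr do rewrite big_ord0; apply; case.
under eq_eseriesr do rewrite big_ord_recl mulrA.
apply: (IH (fun k => w k * (b k ord0 - a k ord0))%R
  (fun k i => a k (lift ord0 i)) (fun k i => b k (lift ord0 i))) => //.
  by move=> k; rewrite mulr_ge0// subr_ge0.
move=> x x01.
pose c k := (w k * \prod_(i < p) \1_(`[a k (lift ord0 i), b k (lift ord0 i)]%classic) (x i))%R.
have c0 k : (0 <= c k)%R by rewrite mulr_ge0// prodr_ge0.
have {}h y : (`[0%R, 1%R]%classic : set R) y ->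
    1 <= \sum_(0 <= k <oo) (c k)%:E * (\1_(`[a k ord0, b k ord0]%classic) y)%:E.
  rewrite /= in_itv /= => y01.
  have := h (fun i => if unlift ord0 i is Some j then x j else y).
  move=> /(_ _)/wrap[i|]; first by case: (unlift ord0 i).
  move/le_trans; apply; rewrite le_eqVlt; apply/orP; left; apply/eqP.
  apply: eq_eseriesr => k _; rewrite -EFinM big_ord_recl unlift_none; congr EFin.
  rewrite /c mulrCA [RHS]mulrC; congr (_ * (_ * _))%R.
  by apply: eq_bigr => i _; rewrite liftK.
have : \int[lebesgue_measure]_(y in `[0%R, 1%R]%classic) (1 : \bar R) <=
  \int[lebesgue_measure]_(y in `[0%R, 1%R]%classic)
    \sum_(0 <= k <oo) (c k)%:E * (\1_(`[a k ord0, b k ord0]%classic) (y : R))%:E.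
  apply: ge0_le_integral => //.
    apply: ge0_emeasurable_sum.
      by move=> k y _ _; rewrite mule_ge0// lee_fin.
    move=> k _; apply: measurable_funeM; apply/measurable_EFinP.
    exact: measurable_indic.
rewrite integral_cst// mul1e.
rewrite [X in X <= _](_ : _ = 1); last first.
  transitivity (lebesgue_measure (`[0%R, 1%R]%classic : set R)); first by [].
  by rewrite lebesgue_measure_itv/= lte_fin ltr01 oppr0 adde0.
move=> /le_trans; apply.
rewrite integral_nneseries//; last 2 first.
- move=> k; apply: measurable_funeM; apply/measurable_EFinP.
  exact: measurable_indic.
- by move=> k y _; rewrite mule_ge0// lee_fin.
apply: lee_nneseries => [k _ _|k _].
  by apply: integral_ge0 => y _; rewrite mule_ge0// lee_fin.
rewrite ge0_integralZl_EFin//; last first.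
- by apply/measurable_EFinP; exact: measurable_indic.
rewrite integral_indic//.
apply: (@le_trans _ _ ((c k)%:E * (b k ord0 - a k ord0)%:E)).
  apply: lee_wpmul2l; first by rewrite lee_fin.
  apply: (@le_trans _ _ (lebesgue_measure `[a k ord0, b k ord0]%classic)).
    by apply: le_measure; rewrite ?inE//; exact: measurableI.
  rewrite lebesgue_measure_itv/= lte_fin; case: ifPn => // _.
  by rewrite lee_fin subr_ge0.
by rewrite -EFinM lee_fin /c mulrAC.
Qed.

Lemma vol_cube_ge1 n : 1 <= vol (box 0%R (\row__ 1%R) : set 'rV[R]_n.+1).
Proof.
apply: le_ereal_inf_tmp => _ [a [b [ab [cov ->]]]].
have := @cube_cover n.+1 (fun=> 1%R) (fun k i => a k 0%R i) (fun k i => b k 0%R i).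
under eq_eseriesr do rewrite mul1r; apply => // x x01.
have [|k _ xk] := cov (\row_i x i); first by move=> i; rewrite !mxE.
rewrite (le_trans _ (nneseries_lim_ge k.+1 _))//; last first.
  by move=> j _ _; rewrite lee_fin mulr_ge0// prodr_ge0.
rewrite big_nat_recr//= (le_trans _ (leeDr _ _))//; last first.
  by apply: sume_ge0 => j _; rewrite lee_fin mulr_ge0// prodr_ge0.
rewrite lee_fin mul1r big1// => i _; rewrite indicE mem_set//=.
by have := xk i; rewrite mxE in_itv.
Qed.

End CubeVolume.

(** * Sweeping convex bodies along segments *)

(** Cauchy's functional equation for monotone functions: squeezing [k * s] between consecutive
    integers bounds [k] times the defect by [g 1], for every [k]. *)
Lemma additive_monotone (R : realType) (g : R -> R) :
  (forall s t, 0 <= s -> 0 <= t -> g (s + t) = g s + g t) ->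
  (forall s t, 0 <= s -> s <= t -> g s <= g t) ->
  forall s, 0 <= s -> g s = s * g 1.
Proof.
move=> gD gle s s0.
have g0 : g 0 = 0 by have := gD 0 0 (lexx _) (lexx _); rewrite addr0; lra.
have gM k t : 0 <= t -> g (k%:R * t) = k%:R * g t.
  move=> t0; elim: k => [|k IH]; first by rewrite !mul0r.
  by rewrite -addn1 natrD !mulrDl !mul1r gD ?mulr_ge0 // IH.
have g1 : 0 <= g 1 by rewrite -g0 gle.
have key k : `|k%:R * (g s - s * g 1)| <= g 1.
  have ks0 : 0 <= k%:R * s by rewrite mulr_ge0.
  have /andP[h1 h2] := truncn_itv ks0.
  set j := Num.truncn _ in h1 h2.
  have := gle _ _ (ler0n _ j) h1; have := gle _ _ ks0 (ltW h2).
  rewrite -[j%:R]mulr1 -[j.+1%:R]mulr1 !gM// -natr1 => h3 h4.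
  have h5 : j%:R * g 1 <= k%:R * s * g 1 by rewrite ler_wpM2r// .
  have h6 : k%:R * s * g 1 <= (j%:R + 1) * g 1.
    by rewrite ler_wpM2r// natr1 ltW.
  rewrite ler_norml; lra.
apply/eqP; rewrite -subr_eq0; apply/negPn/negP => d0.
have dp : 0 < `|g s - s * g 1| by rewrite normr_gt0.
have := key (Num.truncn (g 1 / `|g s - s * g 1|)).+1.
rewrite normrM ger0_norm// -ler_pdivlMr// leNgt.
by rewrite truncnS_gt.
Qed.

Section RealVolume.
Variables (R : realType) (n : nat).
Local Notation V := 'rV[R]_n.+1.
Implicit Types (A B M L : set V) (v : V).

Definition volr A : R := fine (vol A).

Lemma compact_sub_eball A : compact A -> exists2 r, 0 < r & A `<=` eball 0 r.
Proof.
move=> cA; have [->|/set0P A0] := eqVneq A set0; first by exists 1.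
have [|p _ pmax] := @EVT_max_rV R n.+1 (fun z => enorm (z - 0)) A A0 cA.
  by apply: continuous_subspaceT; exact: enormB_continuous.
exists (enorm (p - 0) + 1); first by rewrite ltr_wpDl ?enorm_ge0.
move=> x /mem_set /pmax /le_trans; apply; by rewrite lerDl.
Qed.

Lemma vol_eball_le r : 0 <= r -> (vol (eball (0 : V) r) <= ((2 * r) ^+ n.+1)%:E)%E.
Proof.
move=> r0; have rr (i : 'I_n.+1) : (const_mx (- r) : V) 0 i <= (const_mx r : V) 0 i.
  rewrite !mxE; lra.
apply: le_trans (vol_le (_ : _ `<=` box (const_mx (- r)) (const_mx r))) _.
  move=> x; rewrite /eball /= subr0 => xr i; rewrite !mxE -ler_norml.
  exact: le_trans (coord_le_enorm _ _) xr.
apply: le_trans (vol_box_le rr) _; rewrite lee_fin /box_vol.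
rewrite (eq_bigr (fun=> 2 * r)); last by move=> i _; rewrite !mxE; ring.
by rewrite prodr_const card_ord.
Qed.

Lemma vol_fin_num A : compact A -> vol A \is a fin_num.
Proof.
move=> /compact_sub_eball[r r0 Ar]; rewrite ge0_fin_numE ?vol_ge0//.
by rewrite (le_lt_trans (vol_le Ar))// (le_lt_trans (vol_eball_le (ltW r0)))// ltry.
Qed.

Lemma volrE A : compact A -> vol A = (volr A)%:E.
Proof. by move=> /vol_fin_num /fineK. Qed.

Lemma volr_ge0 A : 0 <= volr A.
Proof. by rewrite fine_ge0 ?vol_ge0. Qed.

Lemma volr_le A B : compact B -> A `<=` B -> volr A <= volr B.
Proof.
move=> cB AB; have Bf := vol_fin_num cB; rewrite fine_le ?vol_le//.
rewrite ge0_fin_numE ?vol_ge0// (le_lt_trans (vol_le AB))// -ge0_fin_numE//.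
exact: vol_ge0.
Qed.

Lemma volr_setD A M : compact A -> compact M -> M `<=` A ->
  volr A = volr M + volr (A `\` M).
Proof.
move=> cA cM MA; rewrite /volr (vol_split A (compact_closed (@norm_hausdorff _ _) cM)).
have Af := vol_fin_num cA.
have Df : vol (A `\` M) \is a fin_num.
  rewrite ge0_fin_numE ?vol_ge0// (le_lt_trans (vol_le (@subDsetl _ A M)))//.
  by rewrite -ge0_fin_numE// vol_ge0.
by rewrite setIC (setIidl MA) fineD// vol_fin_num.
Qed.

Lemma volr_homothety c (s : R) A : 0 < s ->
  volr ((fun x => c + s *: x) @` A) = s ^+ n.+1 * volr A.
Proof.
move=> s0; rewrite /volr vol_homothety//.
have : (0 <= vol A)%E by exact: vol_ge0.
case: (vol A) => [x _//|_|//] /=.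
by rewrite gt0_muley ?mulr0// lte_fin exprn_gt0.
Qed.

Lemma volr_translate c A : volr (+%R c @` A) = volr A.
Proof.
have -> : +%R c = (fun x => c + 1 *: x) by apply/funext => x; rewrite scale1r.
by rewrite volr_homothety// expr1n mul1r.
Qed.

Lemma volr_set0 : volr (set0 : set V) = 0.
Proof. by rewrite /volr vol_set0. Qed.

Lemma volr_gt0 A c r : compact A -> 0 < r -> eball c r `<=` A -> 0 < volr A.
Proof.
move=> cA r0 rA; pose one : V := \row__ 1; pose s := r / (enorm one + 1).
have s0 : 0 < s by rewrite divr_gt0// ltr_wpDl ?enorm_ge0.
suff h : (fun x => c + s *: x) @` box 0 one `<=` A.
  apply: lt_le_trans (volr_le cA h); rewrite volr_homothety// mulr_gt0 ?exprn_gt0//.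
  have := vol_cube_ge1 R n.
  rewrite /volr; have : (vol (box 0 one) <= (box_vol 0 one)%:E)%E.
    by apply: vol_box_le => i; rewrite !mxE.
  rewrite -/one; case: (vol _) => [x _|//|//]; rewrite lee_fin /=.
  exact: lt_le_trans.
move=> _ [x xb <-]; apply: rA; rewrite /eball /= addrAC subrr add0r.
rewrite enormZ gtr0_norm// /s mulrAC ler_pdivrMr ?ltr_wpDl ?enorm_ge0//.
rewrite ler_pM2l// (@le_trans _ _ (enorm one))//; last by rewrite lerDl.
rewrite enorm_le; apply: ler_sum => i _; have := xb i; rewrite !mxE => /andP[h1 h2].
by rewrite ler_pM.
Qed.

(** * Linear growth of the volume along a segment *)

Let hseg v s : set V := (fun t => t *: v) @` `[0, s].

Let hseg_compact v s : compact (hseg v s).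
Proof.
apply: continuous_compact; last exact: segment_compact.
by apply: continuous_subspaceT => t; exact: scalel_continuous.
Qed.

Let hseg_sub v s t : s <= t -> hseg v s `<=` hseg v t.
Proof.
move=> st _ [x /= xs <-]; exists x => //=; move: xs; rewrite !in_itv/= => /andP[-> /le_trans]; exact.
Qed.

(* Everything that sweeping [M] from time [s] to [s + t] along [v] adds is a
   translate of what sweeping it from time [0] to [t] adds. *)
Let hseg_setD M v s t : convex_set M -> 0 <= s -> 0 <= t ->
  minkowski_sum M (hseg v (s + t)) `\` minkowski_sum M (hseg v s) =
  +%R (s *: v) @` (minkowski_sum M (hseg v t) `\` M).
Proof.
move=> cM s0 t0; apply/seteqP; split.
  move=> _ [[x [_ [Mx [[a /= + <-] ->]]]] h]; rewrite in_itv /= => /andP[a0 ast].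
  have sa : s < a.
    rewrite ltNge; apply/negP => as_; apply: h; exists x, (a *: v); split => //.
    by split => //; exists a => //=; rewrite in_itv /= a0.
  exists (x + (a - s) *: v); last by rewrite scalerBl addrC -addrA subrK.
  split.
    exists x, ((a - s) *: v); split => //; split => //; exists (a - s) => //=.
    by rewrite in_itv /= subr_ge0 (ltW sa) lerBlDl.
  move=> Mxa; apply: h; exists (x + (a - s) *: v), (s *: v); split => //.
  split; first by exists s => //=; rewrite in_itv /= s0 lexx.
  by rewrite scalerBl -addrA subrK.
move=> _ [_ [[x [_ [Mx [[a /= + <-] ->]]]] h] <-]; rewrite in_itv /= => /andP[a0 at_].
split.
  exists x, ((s + a) *: v); split => //; split; last by rewrite scalerDl addrCA.
  by exists (s + a) => //=; rewrite in_itv /= addr_ge0//= lerD2l.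
move=> [y [_ [My [[b /= + <-] e]]]]; rewrite in_itv /= => /andP[b0 bs].
apply: h.
have [d0|d0] := eqVneq (s - b + a) 0.
  have -> : a = 0 by lra.
  by rewrite scale0r addr0.
have dp : 0 < s - b + a by rewrite lt_def d0 /=; lra.
(* The point lies between [x] and [y], both in the convex set [M]. *)
have -> : x + a *: v = (1 - a / (s - b + a)) *: x + (a / (s - b + a)) *: y.
  have -> : y = x + (s - b + a) *: v.
    apply/(addIr (b *: v)); rewrite -e -addrA -scalerDl addrCA -scalerDl.
    by congr (_ + _ *: _); ring.
  rewrite scalerDr addrA -scalerDl subrK scale1r scalerA.
  by rewrite divfK.
apply: cM => //; first by rewrite divr_ge0// ltW.
by rewrite ler_pdivrMr// mul1r; lra.
Qed.

(** By [hseg_setD] the added volume is additive in [s]; it is also monotone, hence linear. *)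
Let volr_hseg M v s : compact M -> convex_set M -> 0 <= s ->
  volr (minkowski_sum M (hseg v s)) =
  volr M + s * (volr (minkowski_sum M (hseg v 1)) - volr M).
Proof.
move=> cM vM s0; pose f s := volr (minkowski_sum M (hseg v s)).
have cMv t : compact (minkowski_sum M (hseg v t)) by apply: mink_compact.
have Msub t : 0 <= t -> M `<=` minkowski_sum M (hseg v t).
  move=> t0 x Mx; exists x, 0; split => //; rewrite addr0; split => //.
  by exists 0; rewrite ?scale0r//= in_itv /= lexx.
apply/eqP; rewrite addrC -subr_eq; apply/eqP.
apply: (additive_monotone (g := fun s => f s - volr M)) => // [a b a0 b0|a b a0 ab].
  rewrite /f (@volr_setD _ (minkowski_sum M (hseg v a)))//; last first.
    by apply: mink_sub => //; apply: hseg_sub; rewrite lerDl.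
  rewrite hseg_setD// volr_translate.
  rewrite [in RHS](@volr_setD (minkowski_sum M (hseg v b)) M) //; last exact: Msub.
  ring.
by rewrite lerB// volr_le//; apply: mink_sub => //; exact: hseg_sub.
Qed.

Definition seg v : set V := [set x | exists t, [/\ -1 <= t, t <= 1 & x = t *: v]].

Lemma seg_image v : seg v = (fun t => t *: v) @` `[-1, 1].
Proof.
apply/seteqP; split => [_ [t [h1 h2 ->]]|_ [t /= + <-]].
  by exists t => //=; rewrite in_itv /= h1 h2.
by rewrite in_itv /= => /andP[h1 h2]; exists t.
Qed.

Lemma seg_compact v : compact (seg v).
Proof.
rewrite seg_image; apply: continuous_compact; last exact: segment_compact.
by apply: continuous_subspaceT => t; exact: scalel_continuous.
Qed.

Lemma seg_convex v : convex_set (seg v).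
Proof.
move=> _ _ t [a [a0 a1 ->]] [b [b0 b1 ->]] t0 t1.
exists ((1 - t) * a + t * b); split; [nra|nra|].
by rewrite !scalerA -scalerDl.
Qed.

Lemma volr_seg M v s : compact M -> convex_set M -> 0 <= s ->
  volr (minkowski_sum M (seg (s *: v))) =
  volr M + s * (volr (minkowski_sum M (seg v)) - volr M).
Proof.
move=> cM vM s0.
have E t : 0 <= t -> minkowski_sum M (seg (t *: v)) =
    +%R (- t *: v) @` minkowski_sum M (hseg v (2 * t)).
  move=> t0; apply/seteqP; split.
    move=> _ [x [_ [Mx [[a [a0 a1 ->]] ->]]]].
    exists (x + (t * (a + 1)) *: v); last first.
      by rewrite addrCA -scalerDl scalerA; congr (_ + _ *: _); ring.
    exists x, ((t * (a + 1)) *: v); split => //; split => //.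
    by exists (t * (a + 1)) => //=; rewrite in_itv /=; apply/andP; split; nra.
  move=> _ [_ [x [_ [Mx [[a /= + <-] ->]]]] <-]; rewrite in_itv /= => /andP[a0 a1].
  exists x, (a *: v - t *: v); split => //; split; last by rewrite scaleNr addrCA [- _ + _]addrC.
  have [t00|tn0] := eqVneq t 0.
    have a00 : a = 0 by lra.
    by exists 0; split; [lra|lra|]; rewrite t00 a00 !scale0r subr0.
  have tp : 0 < t by rewrite lt_def tn0.
  exists (a / t - 1); split; last by rewrite scalerBl scalerA divfK// scale1r.
    by rewrite lerBrDl addrN divr_ge0// ltW.
  by rewrite lerBlDr ler_pdivrMr.
have := E 1 ler01; rewrite scale1r => ->.
rewrite E// !volr_translate !(@volr_hseg _ _ (_ * _))// ?mulr_ge0//; ring.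
Qed.

(** * Zonotopes and separately affine functions *)

Definition zono (vs : seq V) : set V :=
  foldr (fun v A => minkowski_sum (seg v) A) [set 0] vs.

Lemma zono_compact vs : compact (zono vs).
Proof.
elim: vs => [|v vs IH] /=; first exact: compact_set1.
by apply: mink_compact => //; exact: seg_compact.
Qed.

Lemma zono_convex vs : convex_set (zono vs).
Proof.
elim: vs => [|v vs IH] /=; last by apply: mink_convex => //; exact: seg_convex.
by move=> _ _ t -> -> _ _ /=; rewrite !scaler0 addr0.
Qed.

(** Separate affinity on the nonnegative orthant, for functions of [m] variables given as a list:
    affine in the first variable for each tail and, recursively, in the tail for each first
    variable. *)
Fixpoint sepaff m (F : seq R -> R) : Prop :=
  if m is m'.+1 then
    (forall x l, 0 <= x -> size l = m' -> all (>= 0) l ->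
      F (x :: l) = F (0 :: l) + x * (F (1 :: l) - F (0 :: l))) /\
    forall x, 0 <= x -> sepaff m' (fun l => F (x :: l))
  else True.

Lemma sepaffB m F G : sepaff m F -> sepaff m G -> sepaff m (fun l => F l - G l).
Proof.
elim: m F G => //= m IH F G [F1 F2] [G1 G2]; split => [x l x0 ml l0|x x0].
  rewrite F1// G1//; ring.
by apply: IH; [exact: F2|exact: G2].
Qed.

(** As a function of its first variable, [F] has nonnegative slope, since it would otherwise become
    negative far out. Induction on the value at 0 and on the slope gives [p0] and [p1]. *)
Lemma sepaff_diag m F : sepaff m F ->
  (forall l, size l = m -> all (>= 0) l -> 0 <= F l) ->
  exists p : {poly R}, (forall i, 0 <= p`_i) /\
    forall s, 0 <= s -> F (nseq m s) = p.[s].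
Proof.
elim: m F => [|m IH] F.
  move=> _ F0; exists (F [::])%:P; split; last by move=> s _; rewrite hornerC.
  by move=> i; rewrite coefC; case: ifP => // _; exact: F0.
move=> [F1 F2] F0.
have [|p0 [p00 p0E]] := IH _ (F2 0 (lexx _)).
  by move=> l lm l0; apply: F0 => /=; rewrite ?lm ?lexx.
have [|p1 [p10 p1E]] := IH _ (sepaffB (F2 1 ler01) (F2 0 (lexx _))).
  move=> l lm l0; rewrite leNgt; apply/negP => d0.
  pose c := F (1 :: l) - F (0 :: l).
  have F00 : 0 <= F (0 :: l) by apply: F0; rewrite /= ?lm ?lexx.
  have x0 : 0 <= (F (0 :: l) + 1) / - c by rewrite divr_ge0 ?addr_ge0// oppr_ge0 ltW.
  (* At this value of the first variable [F] would equal -1. *)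
  have := F0 ((F (0 :: l) + 1) / - c :: l).
  rewrite /= lm x0 l0 => /(_ erefl erefl).
  rewrite F1// -/c -[X in _ * X]opprK mulrN divfK ?oppr_eq0 ?lt_eqF//; lra.
exists (p0 + p1 * 'X); split => [i|s s0].
  by rewrite coefD coefMX; case: ifP => // _; rewrite ?addr0// addr_ge0.
rewrite /= F1 ?size_nseq ?all_nseq ?s0 ?orbT// hornerD hornerMX -p0E// -p1E//; ring.
Qed.

Let zsc (l : seq R) (vs : seq V) := [seq p.1 *: p.2 | p <- zip l vs].

(** The segment of the first variable can be added last, where [volr_seg] applies; for the tail it
    is absorbed into [M]. *)
Let volr_zono_sepaff M vs : compact M -> convex_set M ->
  sepaff (size vs) (fun l => volr (minkowski_sum M (zono (zsc l vs)))).
Proof.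
elim: vs M => //= v vs IH M cM vM.
have E x l : minkowski_sum M (minkowski_sum (seg (x *: v)) (zono (zsc l vs))) =
    minkowski_sum (minkowski_sum M (zono (zsc l vs))) (seg (x *: v)).
  by rewrite (minkC (seg _)) minkA.
split => [x l x0 lm l0|x x0].
  have cZ : compact (minkowski_sum M (zono (zsc l vs))).
    by apply: mink_compact => //; exact: zono_compact.
  have vZ : convex_set (minkowski_sum M (zono (zsc l vs))).
    by apply: mink_convex => //; exact: zono_convex.
  by rewrite /zsc /= -/(zsc l vs) !E !volr_seg//; ring.
have -> : (fun l => volr (minkowski_sum M (zono (zsc (x :: l) (v :: vs))))) =
    (fun l => volr (minkowski_sum (minkowski_sum M (seg (x *: v))) (zono (zsc l vs)))).
  by apply/funext => l; rewrite /zsc /= minkA.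
apply: IH; first by apply: mink_compact => //; exact: seg_compact.
by apply: mink_convex => //; exact: seg_convex.
Qed.

(** The difference is separately affine in the scalings of the generators, and nonnegative because
    [M] is contained in [L]; equal scalings give its diagonal. *)
Lemma volr_zono_poly L M vs : compact L -> convex_set L -> compact M -> convex_set M ->
  M `<=` L ->
  exists p : {poly R}, (forall i, 0 <= p`_i) /\ forall s, 0 <= s ->
    volr (minkowski_sum L (zono [seq s *: v | v <- vs])) -
    volr (minkowski_sum M (zono [seq s *: v | v <- vs])) = p.[s].
Proof.
move=> cL vL cM vM ML.
have [|p [p0 pE]] :=
  sepaff_diag (sepaffB (volr_zono_sepaff vs cL vL) (volr_zono_sepaff vs cM vM)).
  move=> l _ _; rewrite subr_ge0 volr_le//; last exact: mink_sub.
  by apply: mink_compact => //; exact: zono_compact.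
exists p; split => // s s0; rewrite -pE//.
have -> // : zsc (nseq (size vs) s) vs = [seq s *: v | v <- vs].
by elim: vs {p0 pE p} => //= v vs IH; rewrite -IH.
Qed.

End RealVolume.

(** * Approximating the ball by zonotopes *)

Section Zonotope.
Variables (R : realType) (n : nat).
Local Notation V := 'rV[R]_n.+1.
Implicit Types (u v w x p q : V) (vs qs : seq V).

(** The support function of [zono vs]. *)
Definition hzono vs u : R := \sum_(v <- vs) `|edot v u|.

Lemma edot_zono_le vs x u : zono vs x -> edot x u <= hzono vs u.
Proof.
elim: vs x => [_ ->|v vs IH _ [_ [y [[t [t0 t1 ->]] [/IH yh ->]]]]].
  by rewrite edot0l /hzono big_nil.
rewrite /hzono big_cons edotDl lerD//.
rewrite edotZl (le_trans (ler_norm _))// normrM -[leRHS]mul1r ler_wpM2r//.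
by rewrite ler_norml t0.
Qed.

Lemma zono_support vs u : exists2 x, zono vs x & edot x u = hzono vs u.
Proof.
elim: vs => [|v vs [x xz xh]]; first by exists 0; rewrite // edot0l /hzono big_nil.
exists (Num.sg (edot v u) *: v + x).
  exists (Num.sg (edot v u) *: v), x; split => //; exists (Num.sg (edot v u)).
  by split => //; have := sgrP (edot v u); case => _; lra.
by rewrite edotDl edotZl -normrEsg xh /hzono big_cons.
Qed.

Lemma zono_sub_eball vs r : (forall u, hzono vs u <= r * enorm u) -> zono vs `<=` eball 0 r.
Proof.
move=> h x xz; rewrite /eball /= subr0.
have [->|x0] := eqVneq x 0.
  (* At a nonzero vector the hypothesis forces [r] to be nonnegative. *)
  rewrite enorm0; have := h (\row_(i < n.+1) 1); have : 0 <= hzono vs (\row_(i < n.+1) 1) by apply: sumr_ge0.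
  move=> /le_trans h1 /h1; rewrite pmulr_lge0// enorm_gt0; apply/eqP => /rowP/(_ ord0).
  by rewrite !mxE; apply/eqP; rewrite oner_eq0.
have := le_trans (edot_zono_le x xz) (h x).
by rewrite -sqr_enorm expr2 ler_pM2r// enorm_gt0.
Qed.

Lemma eball_sub_zono vs r : (forall u, r * enorm u <= hzono vs u) -> eball 0 r `<=` zono vs.
Proof.
move=> h x; rewrite /eball /= subr0 => xr; apply: contrapT => xz.
have [z0 z0z _] := zono_support vs 0.
have [|u u0 uz] := separation (@zono_compact _ _ vs) (@zono_convex _ _ vs) _ xz.
  by exists z0.
have [z /uz zx zu] := zono_support vs u; move: zx; rewrite zu ltNge => /negP; apply.
by rewrite (le_trans (cauchy_schwarz _ _))// (le_trans _ (h u))// ler_wpM2r ?enorm_ge0.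
Qed.

Lemma hzono_map_scale s vs u : 0 <= s ->
  hzono [seq s *: v | v <- vs] u = s * hzono vs u.
Proof.
move=> s0; rewrite /hzono big_map mulr_sumr; apply: eq_bigr => v _.
by rewrite edotZl normrM ger0_norm.
Qed.

Lemma hzonoZ s vs u : hzono vs (s *: u) = `|s| * hzono vs u.
Proof. by rewrite /hzono mulr_sumr; apply: eq_bigr => v _; rewrite edotZr normrM. Qed.

(** The reflection in the hyperplane orthogonal to [w]; for [w = 0] it is the identity, as the
    correction is a multiple of [w]. *)
Let refl w x := x - (2 * edot x w / edot w w) *: w.

Let edot_refl w x y : edot (refl w x) y = edot x (refl w y).
Proof. rewrite /refl !edotE (edotC w y); ring. Qed.

Let refl_enorm w x : enorm (refl w x) = enorm x.
Proof.
rewrite /enorm edot_refl /refl; congr Num.sqrt.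
have [->|w0] := eqVneq w 0; first by rewrite !(scaler0, subr0).
have : edot w w != 0 by rewrite edot_eq0.
by rewrite !edotE => w1; field.
Qed.

Let reflB w x y : refl w (x - y) = refl w x - refl w y.
Proof. by rewrite /refl edotDl edotNl; apply/rowP => i; rewrite !mxE; ring. Qed.

Let refl_swap p q : enorm p = enorm q -> refl (p - q) q = p.
Proof.
move=> /(congr1 (fun a : R => a ^+ 2)); rewrite !sqr_enorm => pq.
have [w0|w0] := eqVneq (p - q) 0.
  by rewrite /refl w0 scaler0 subr0; apply/esym/eqP; rewrite -subr_eq0 w0.
rewrite /refl (_ : _ / _ = -1); first by rewrite scaleN1r opprK addrC subrK.
have : edot (p - q) (p - q) != 0 by rewrite edot_eq0.
rewrite !edotE pq (edotC q p) => h; field.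
by apply: contra_neq h => <-; ring.
Qed.

Let sphere_net (r : R) : 0 < r -> exists qs, (forall q, q \in qs -> enorm q = 1) /\
  forall u, enorm u = 1 -> exists2 q, q \in qs & enorm (u - q) <= r.
Proof.
move=> r0; pose S : set V := [set x | enorm x = 1].
have cS : compact S.
  apply: (@subclosed_compact _ _ (eball 0 1)); [|exact: compact_eball|]; last first.
    by move=> x; rewrite /S /eball /= subr0 => ->.
  rewrite (_ : S = @enorm _ _ @^-1` [set 1])//.
  by apply: closed_comp; [move=> x _; exact: enorm_continuous|exact: closed_eq].
have := cS; rewrite compact_cover => /(_ V S (fun q => [set x | enorm (x - q) < r])).
case.
- move=> q _; rewrite (_ : [set _ | _] = (fun x => enorm (x - q)) @^-1` [set x | x < r])//.
  by apply: open_comp; [move=> x _; exact: enormB_continuous|exact: open_lt].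
- by move=> x Sx; exists x => //=; rewrite subrr enorm0.
move=> D DS cov; exists (finmap.enum_fset D); split.
  by move=> q /DS; rewrite inE.
by move=> u /cov[q /= Dq /ltW uq]; exists q.
Qed.

Let N : R := n.+1%:R.

Let N1 : 1 <= N. Proof. by rewrite /N ler1n. Qed.

Let e0 : V := delta_mx 0 ord0.

Let enorm_e0 : enorm e0 = 1.
Proof.
rewrite /enorm /edot (bigD1 ord0)//= big1 => [|i /negPf i0]; last first.
  by rewrite !mxE i0 mulr0.
by rewrite !mxE !eqxx mulr1 addr0 sqrtr1.
Qed.

(** A Lipschitz constant and a lower bound on the sphere, both inherited by averages over
    reflections. The common constant [N] lets one net of the sphere serve all averaging steps. *)
Let good vs := (forall u v, hzono vs u - hzono vs v <= N * enorm (u - v)) /\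
  (forall u, enorm u = 1 -> 1 <= hzono vs u).

(** The generators are the standard basis: the zonotope is a cube and its support function the l1
    norm. *)
Let good_cross : exists2 vs, good vs & forall u, enorm u = 1 -> hzono vs u <= N.
Proof.
have E u : hzono [seq delta_mx 0 i | i <- enum 'I_n.+1] u = \sum_i `|u 0 i|.
  rewrite /hzono big_map big_enum /=; apply: eq_bigr => i _; congr `|_|.
  rewrite /edot (bigD1 i)//= big1 => [|j /negPf ji]; last by rewrite !mxE ji mul0r.
  by rewrite !mxE !eqxx mul1r addr0.
have sumN (f : 'I_n.+1 -> R) (c : R) : (forall i, f i <= c) -> \sum_i f i <= N * c.
  move=> fc; apply: (@le_trans _ _ (\sum_(i < n.+1) c)); first exact: ler_sum.
  by rewrite sumr_const card_ord mulr_natl.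
exists [seq delta_mx 0 i | i <- enum 'I_n.+1]; [split|].
- move=> u v; rewrite !E -sumrB; apply: sumN => i.
  rewrite (le_trans (lerB_dist _ _))//.
  by rewrite (_ : u 0 i - v 0 i = (u - v) 0 i) ?coord_le_enorm// !mxE.
- move=> u u1; rewrite E; have := sqr_enorm u; rewrite u1 expr1n => ->.
  apply: ler_sum => i _; rewrite -expr2 -real_normK ?num_real// expr2.
  by rewrite -[leRHS]mulr1 ler_wpM2l// -u1 coord_le_enorm.
- by move=> u u1; rewrite E -[leRHS]mulr1; apply: sumN => i; rewrite -u1 coord_le_enorm.
Qed.

(* Averaging over the reflections that carry the points of a net of the sphere
   to a point where the support function is small lowers its maximum by a
   fixed amount. *)
Let good_average (eta : R) : 0 < eta -> exists2 d, 0 < d & forall vs (M : R) p,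
  good vs -> (forall u, enorm u = 1 -> hzono vs u <= M) ->
  enorm p = 1 -> hzono vs p < M - eta ->
  exists2 vs', good vs' & forall u, enorm u = 1 -> hzono vs' u <= M - d.
Proof.
move=> eta0; have Np : 0 < N by apply: lt_le_trans N1.
(* Within this distance of a net point the Lipschitz bound costs at most half of [eta]. *)
have [|qs [qs1 qsnet]] := @sphere_net (eta / (2 * N)).
  by rewrite divr_gt0// mulr_gt0.
pose k : R := (size qs)%:R.
have k0 : 0 < k.
  rewrite ltr0n; have [q + _] := qsnet _ enorm_e0; by case: qs {k qs1 qsnet}.
exists (eta / (2 * k)); first by rewrite divr_gt0// mulr_gt0.
move=> vs M p [vsL vs1] vsM p1 pM.
pose vs' := flatten [seq [seq k^-1 *: refl (p - q) v | v <- vs] | q <- qs].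
have E u : hzono vs' u = k^-1 * \sum_(q <- qs) hzono vs (refl (p - q) u).
  rewrite /hzono /vs' big_flatten big_map mulr_sumr; apply: eq_bigr => q _.
  rewrite big_map mulr_sumr; apply: eq_bigr => v _.
  by rewrite edotZl edot_refl normrM gtr0_norm ?invr_gt0.
have avg (f : V -> R) c : (forall q, q \in qs -> f q <= c) -> k^-1 * \sum_(q <- qs) f q <= c.
  move=> fc; rewrite ler_pdivrMl// (@le_trans _ _ (\sum_(q <- qs) c))//.
    by rewrite big_seq [leRHS]big_seq; exact: ler_sum.
  by rewrite big_const_seq count_predT iter_addr_0 /k mulr_natl.
exists vs'; first split.
- move=> u v; rewrite !E -mulrBr -sumrB; apply: avg => q _.
  by rewrite (le_trans (vsL _ _))// -reflB refl_enorm.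
- move=> u u1; rewrite E -[leRHS]opprK lerNr -mulrN -sumrN; apply: avg => q _.
  by rewrite lerN2 vs1// refl_enorm.
move=> u u1; rewrite E ler_pdivrMl//.
(* Reflecting with the net point [q] near [u] brings [u] close to [p], so this one of the [k] terms
   gains [eta / 2]; the others are at most [M]. *)
have [q qq uq] := qsnet _ u1.
rewrite (big_rem q qq) /=.
have h1 : hzono vs (refl (p - q) u) <= M - eta / 2.
  have := vsL (refl (p - q) u) p.
  have -> : refl (p - q) u - p = refl (p - q) (u - q) by rewrite reflB refl_swap ?p1 ?qs1//.
  rewrite refl_enorm => h.
  have : N * enorm (u - q) <= eta / 2.
    by move: uq; rewrite ler_pdivlMr ?mulr_gt0//; lra.
  lra.
have h2 : \sum_(y <- rem q qs) hzono vs (refl (p - y) u) <= (k - 1) * M.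
  apply: (@le_trans _ _ (\sum_(y <- rem q qs) M)).
    by apply: ler_sum => y _; rewrite vsM// refl_enorm.
  rewrite big_const_seq count_predT iter_addr_0 size_rem// /k.
  by case: (qs) qq => //= ? ? _; rewrite -natr1 addrK mulr_natl.
have -> : k * (M - eta / (2 * k)) = k * M - eta / 2 by field; lra.
lra.
Qed.

(** While the support function oscillates by more than [e] on the sphere, averaging lowers its upper
    bound by [d]. As it stays at least 1 there, this stops, and the resulting zonotope is
    rescaled. *)
Lemma ball_zono_approx (e : R) : 0 < e -> exists vs : seq V,
  forall s, 0 <= s -> eball 0 s `<=` zono [seq s *: v | v <- vs] /\
    zono [seq s *: v | v <- vs] `<=` eball 0 ((1 + e) * s).
Proof.
move=> ep.
have [vs [c [gvs ch]]] : exists vs c, good vs /\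
    forall u, enorm u = 1 -> c <= hzono vs u <= c + e.
  have [d d0 step] := good_average ep.
  apply: contrapT => nex.
  have iter j : exists2 vs, good vs & forall u, enorm u = 1 -> hzono vs u <= N - j%:R * d.
    elim: j => [|j [vs gvs h]]; first by rewrite mul0r subr0; exact: good_cross.
    have [[p [p1 ph]]|np] := pselect (exists p, enorm p = 1 /\ hzono vs p < N - j%:R * d - e).
      have [vs' gvs' h'] := step vs _ p gvs h p1 ph.
      exists vs' => // u u1; apply: le_trans (h' u u1) _; rewrite -natr1; lra.
    case: nex; exists vs, (N - j%:R * d - e); split => // u u1.
    rewrite subrK h// andbT leNgt; apply/negP => uh; apply: np; by exists u.
  have [vs gvs h] := iter (Num.truncn (N / d)).+1.
  have := h _ enorm_e0; have := gvs.2 _ enorm_e0.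
  have : N < (Num.truncn (N / d)).+1%:R * d by rewrite -ltr_pdivrMr// truncnS_gt.
  lra.
(* Since [b] is at least 1, dividing by [b] keeps the relative error at most [e]. *)
pose b := Num.max c 1.
have b1 : 1 <= b by rewrite le_max lexx orbT.
have b0 : 0 < b by apply: lt_le_trans b1.
have bh u : enorm u = 1 -> b <= hzono vs u <= b + e.
  move=> u1; have /andP[h1 h2] := ch u u1; have := gvs.2 u u1.
  rewrite /b ge_max h1 => -> /=; rewrite (le_trans h2)// lerD2r le_max lexx //.
have bhu u : b * enorm u <= hzono vs u <= (b + e) * enorm u.
  have [->|u0] := eqVneq u 0.
    have -> : hzono vs 0 = 0 by rewrite -(scale0r (0 : V)) hzonoZ normr0 mul0r.
    by rewrite enorm0 !mulr0 lexx.
  have up : 0 < enorm u by rewrite enorm_gt0.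
  have := bh ((enorm u)^-1 *: u).
  rewrite enormZ gtr0_norm ?invr_gt0// mulVf ?gt_eqF// => /(_ erefl).
  by rewrite hzonoZ gtr0_norm ?invr_gt0// ler_pdivlMl// ler_pdivrMl// ![enorm u * _]mulrC.
have bi : 0 <= b^-1 by rewrite invr_ge0 ltW.
exists [seq b^-1 *: v | v <- vs] => s s0; split.
  apply: eball_sub_zono => u; rewrite !hzono_map_scale// ler_wpM2l//.
  by rewrite ler_pdivlMl//; have /andP[] := bhu u.
apply: zono_sub_eball => u; rewrite !hzono_map_scale// mulrAC [leRHS]mulrC ler_wpM2l//.
rewrite ler_pdivrMl// mulrA; have /andP[_ /le_trans] := bhu u; apply.
rewrite ler_wpM2r ?enorm_ge0//; nra.
Qed.
End Zonotope.

(** * Monotonicity of the Steiner coefficients *)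

Section Coefficients.
Variable R : realType.

(** For [i < m] the weights are entries of an inverse Vandermonde matrix; the point is that they do
    not depend on [f]. *)
Lemma coef_interpolation m (s : 'I_m -> R) i : injective s ->
  exists c : 'I_m -> R, forall f : {poly R}, (size f <= m)%N ->
    f`_i = \sum_j c j * f.[s j].
Proof.
move=> sI; have [im|mi] := ltnP i m; last first.
  exists (fun=> 0) => f fm; rewrite nth_default ?(leq_trans fm)//.
  by rewrite big1// => j _; rewrite mul0r.
pose W := Vandermonde m (\row_j s j).
have Wu : W \in unitmx.
  rewrite unitmxE det_Vandermonde unitfE; apply/prodf_neq0 => j _.
  apply/prodf_neq0 => k jk; rewrite !mxE subr_eq0; apply/eqP => /sI kj.
  by rewrite kj ltnn in jk.
exists (fun j => invmx W j (Ordinal im)) => f fm.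
have /(congr1 (fun M => M *m invmx W)) : (\row_k f`_k : 'rV_m) *m W = \row_j f.[s j].
  apply/rowP => j; rewrite !mxE (horner_coef_wide _ fm).
  by apply: eq_bigr => k _; rewrite !mxE.
rewrite mulmxK// => /rowP /(_ (Ordinal im)); rewrite !mxE => ->.
by apply: eq_bigr => j _; rewrite !mxE mulrC.
Qed.

Lemma horner_small (G : {poly R}) (eta : R) : G.[0] = 0 -> 0 < eta ->
  exists e, [/\ 0 < e, e <= 1 & G.[e] < eta].
Proof.
rewrite horner_coef0 => G0 eta0.
pose K := \sum_(i < size G) `|G`_i|.
have K0 : 0 <= K by apply: sumr_ge0.
pose e := Num.min 1 (eta / (K + 1)).
have e0 : 0 < e by rewrite lt_min ltr01 divr_gt0// ltr_wpDl.
have e1 : e <= 1 by rewrite ge_min lexx.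
exists e; split => //.
apply: (@le_lt_trans _ _ (e * K)).
  rewrite horner_coef mulr_sumr; apply: ler_sum => -[[|i] /= _] _.
    by rewrite G0 mul0r normr0 mulr0.
  rewrite exprS mulrCA ler_wpM2l ?(ltW e0)// (le_trans (ler_norm _))//.
  by rewrite normrM ler_piMr// normrX exprn_ile1// gtr0_norm.
have : e * (K + 1) <= eta by rewrite -ler_pdivlMr ?ltr_wpDl// ge_min lexx orbT.
lra.
Qed.

(** Nonnegative coefficients exclude cancellation, so a single term of degree above [m] would
    outgrow the bound. *)
Lemma nonneg_poly_size (f : {poly R}) (C : R) m : (forall i, 0 <= f`_i) ->
  (forall s, 1 <= s -> f.[s] <= C * s ^+ m) -> (size f <= m.+1)%N.
Proof.
move=> f0 fC; apply/leq_sizeP => i mi; apply/eqP; rewrite eq_le f0 andbT leNgt.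
apply/negP => fi.
have key s : 1 <= s -> f`_i * s <= C.
  move=> s1; have s0 : 0 < s by apply: lt_le_trans s1.
  have sm0 : 0 < s ^+ m by rewrite exprn_gt0.
  rewrite -(ler_pM2r sm0) (le_trans _ (fC s s1))// -mulrA -exprS.
  have si : (i < size f)%N.
    by rewrite ltnNge; apply/negP => /(nth_default 0) h; rewrite h ltxx in fi.
  rewrite horner_coef (bigD1 (Ordinal si))//= -[leLHS]addr0 lerD//.
    by rewrite ler_wpM2l// ler_weXn2l.
  by apply: sumr_ge0 => j _; rewrite mulr_ge0// exprn_ge0// ltW.
have C0 : 0 <= C by apply: le_trans (key 1 (lexx _)); rewrite mulr1.
(* Here the bound says that [C] plus the positive coefficient is at most [C]. *)
have := key (C / f`_i + 1); rewrite lerDr divr_ge0// mulrDr mulrCA divff ?gt_eqF//.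
by move=> /(_ isT); lra.
Qed.

Variable n : nat.
Local Notation V := 'rV[R]_n.+1.
Implicit Types (L M : set V) (p q : {poly R}).

Let mink_eball_le L s t : compact L -> s <= t ->
  volr (minkowski_sum L (eball 0 s)) <= volr (minkowski_sum L (eball 0 t)).
Proof.
move=> cL st; apply: volr_le; first by apply: mink_compact => //; exact: compact_eball.
by apply: mink_sub => // x /le_trans; exact.
Qed.

Lemma volr_growth L : compact L -> exists C, forall s, 1 <= s ->
  volr (minkowski_sum L (eball 0 s)) <= C * s ^+ n.+1.
Proof.
move=> cL; have [r r0 Lr] := compact_sub_eball cL.
exists ((2 * (r + 1)) ^+ n.+1) => s s1; have s0 : 0 < s by apply: lt_le_trans s1.
have cE : compact (eball (0 : V) ((r + 1) * s)) by exact: compact_eball.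
apply: (@le_trans _ _ (volr (eball (0 : V) ((r + 1) * s)))).
  apply: volr_le => // x /(mink_sub Lr (@subset_refl _ _)).
  rewrite mink_eballD ?addr0 ?(ltW s0) ?(ltW r0)// => /le_trans; apply; nra.
rewrite -lee_fin -volrE// (le_trans (vol_eball_le _ _))//.
  by rewrite mulr_ge0 ?ltW// addr_gt0.
by rewrite mulrA exprMn.
Qed.

(* Replacing the ball by zonotopes that converge to it, the difference of the
   two volumes is a limit of polynomials with nonnegative coefficients. *)
Lemma steiner_coef_le L M p q r :
  compact L -> convex_set L -> compact M -> convex_set M -> M `<=` L -> 0 <= r ->
  (size p <= n.+2)%N -> (size q <= n.+2)%N ->
  (forall s, r <= s -> volr (minkowski_sum L (eball 0 s)) = p.[s]) ->
  (forall s, r <= s -> volr (minkowski_sum M (eball 0 s)) = q.[s]) ->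
  forall i, q`_i <= p`_i.
Proof.
move=> cL vL cM vM ML r0 sp sq pE qE i; rewrite leNgt; apply/negP => piq.
pose s (j : 'I_n.+2) : R := r + j.+1%:R.
have sI : injective s.
  by move=> j k /addrI /eqP; rewrite eqr_nat eqSS => /eqP /val_inj.
have [c cE] := coef_interpolation i sI.
have s0 j : 0 <= s j by rewrite addr_ge0.
have rs j (e : R) : 0 <= e -> r <= (1 + e) * s j.
  move=> e0; have := s0 j; have : r <= s j by rewrite lerDl.
  nra.
(* [G.[e]] bounds the error in the interpolated coefficient when the balls of radii [s j] are
   replaced by zonotopes that exceed them by a factor of at most [1 + e]; it vanishes at [e = 0]. *)
pose G : {poly R} := \sum_j `|c j| *: (p \Po ((1 + 'X) * (s j)%:P) - (p.[s j])%:P +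
  (q \Po ((1 + 'X) * (s j)%:P) - (q.[s j])%:P)).
have GE e : G.[e] = \sum_j `|c j| * (p.[(1 + e) * s j] - p.[s j] + (q.[(1 + e) * s j] - q.[s j])).
  rewrite horner_sum; apply: eq_bigr => j _.
  by rewrite !hornerE !horner_comp !hornerE.
have [||e [e0 e1 Ge]] := @horner_small G (q`_i - p`_i).
- by rewrite GE big1// => j _; rewrite addr0 mul1r !subrr addr0 mulr0.
- by rewrite subr_gt0.
have [vs vsE] := @ball_zono_approx R n e e0.
pose Z t := zono [seq t *: v | v <- vs].
have [f [f0 fE]] := volr_zono_poly vs cL vL cM vM ML.
have cZ A t : compact A -> compact (minkowski_sum A (Z t)).
  by move=> cA; apply: mink_compact => //; exact: zono_compact.
have between A t : compact A -> 0 <= t ->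
    volr (minkowski_sum A (eball 0 t)) <= volr (minkowski_sum A (Z t)) <=
    volr (minkowski_sum A (eball 0 ((1 + e) * t))).
  move=> cA t0; have [h1 h2] := vsE t t0; apply/andP; split.
    by apply: volr_le; [exact: cZ|exact: mink_sub].
  by apply: volr_le; [apply: mink_compact => //; exact: compact_eball|exact: mink_sub].
(* The growth of volumes bounds the degree of [f] whatever the number of generators, so the weights
   [c] apply to [f] too. *)
have sf : (size f <= n.+2)%N.
  have [C CE] := volr_growth cL.
  apply: (@nonneg_poly_size f (C * 2 ^+ n.+1)) => // t t1.
  have t0 : 0 <= t by apply: le_trans t1.
  rewrite -fE// -[leRHS]subr0 lerB ?volr_ge0//.
  have /andP[_ /le_trans] := between L t cL t0; apply.
  rewrite (le_trans (@mink_eball_le _ _ (2 * t) _ _))//; first by nra.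
  by rewrite -mulrA -exprMn CE//; lra.
have : f`_i <= p`_i - q`_i + G.[e].
  rewrite !cE// GE -sumrB -big_split /=; apply: ler_sum => j _.
  rewrite -mulrBr.
  have sj : r <= s j by rewrite lerDl.
  have := between L _ cL (s0 j); have := between M _ cM (s0 j).
  rewrite !pE ?rs ?(ltW e0)// !qE ?rs ?(ltW e0)// -fE//.
  set b := volr _; set a := volr _ => /andP[b1 b2] /andP[a1 a2].
  have : c j * (a - b - (p.[s j] - q.[s j])) <= `|c j| * `|a - b - (p.[s j] - q.[s j])|.
    by rewrite -normrM ler_norm.
  have : `|a - b - (p.[s j] - q.[s j])| <=
      p.[(1 + e) * s j] - p.[s j] + (q.[(1 + e) * s j] - q.[s j]).
    by rewrite ler_norml; lra.
  move=> /(ler_wpM2l (normr_ge0 (c j))). lra.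
have := f0 i; lra.
Qed.

End Coefficients.

(** * Parallelograms *)

Section Parallelogram.
Variables (R : realType) (n : nat).
Local Notation V := 'rV[R]_n.+1.
Implicit Types (L M : set V) (a b v w : V).
Local Notation B s := (eball (0 : V) s).

(** By [volr_seg], the rate at which the volume grows when [M] is swept along [v]. *)
Let slope v M : R := volr (minkowski_sum M (seg v)) - volr M.

Let cS M v : compact M -> compact (minkowski_sum M (seg v)).
Proof. by move=> cM; apply: mink_compact => //; exact: seg_compact. Qed.

Let vS M v : convex_set M -> convex_set (minkowski_sum M (seg v)).
Proof. by move=> cM; apply: mink_convex => //; exact: seg_convex. Qed.

Let mink_segC M a b : minkowski_sum (minkowski_sum M (seg a)) (seg b) =
  minkowski_sum (minkowski_sum M (seg b)) (seg a).
Proof. by rewrite -!minkA (minkC (seg a)). Qed.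

Let slope_seg M a b t : compact M -> convex_set M -> 0 <= t ->
  slope a (minkowski_sum M (seg (t *: b))) =
  slope a M + t * (slope a (minkowski_sum M (seg b)) - slope a M).
Proof.
move=> cM vM t0; rewrite /slope mink_segC !volr_seg//; first last.
- exact: vS.
- exact: cS.
by rewrite (mink_segC M a b); ring.
Qed.

(* [M] and its translate by [t v] are disjoint parts of [M + t [-v, v]]. *)
Let slope_ge M v t : compact M -> convex_set M -> 0 < t ->
  (forall x, M x -> ~ M (x + t *: v)) -> volr M <= t * slope v M.
Proof.
move=> cM vM t0 disj.
have := volr_seg v cM vM (ltW t0); rewrite -/(slope v M) => E.
suff : volr M + volr M <= volr (minkowski_sum M (seg (t *: v))) by lra.
rewrite (@volr_setD _ _ (minkowski_sum M (seg (t *: v))) M) ?lerD2l//; first last.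
- move=> x Mx; exists x, 0; split => //; rewrite addr0; split => //.
  by exists 0; rewrite scale0r; split=> //; lra.
- exact: cS.
rewrite -(volr_translate (t *: v)) -lee_fin.
have sub : +%R (t *: v) @` M `<=` minkowski_sum M (seg (t *: v)) `\` M.
  move=> _ [x Mx <-]; split; last by rewrite addrC; exact: disj.
  exists x, (t *: v); split => //; rewrite addrC; split => //.
  by exists 1; rewrite scale1r; split=> //; lra.
rewrite lee_fin fine_le ?vol_le//.
- by rewrite -mink1; apply: vol_fin_num; apply: mink_compact => //; exact: compact_set1.
- rewrite ge0_fin_numE ?vol_ge0// (le_lt_trans (vol_le (@subDsetl _ _ M)))//.
  by rewrite -ge0_fin_numE ?vol_ge0// vol_fin_num//; exact: cS.
Qed.

Let cB s : compact (B s). Proof. exact: compact_eball. Qed.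
Let vB s : convex_set (B s). Proof. exact: convex_eball. Qed.

(** Were the second difference not positive, the slope along [a] of the ball lengthened by
    [seg (x *: b)] would stay bounded above as [x] grows. But by [slope_ge] it is at least a fixed
    fraction of the volume, which grows linearly in [x]. *)
Let slope_seg_gt0 a b : b != 0 -> a - (edot a b / edot b b) *: b != 0 ->
  0 < slope a (minkowski_sum (B 1) (seg b)) - slope a (B 1).
Proof.
(* [w] is the component of [a] orthogonal to [b]: lengthening along [b] keeps the width in the
   direction [w], so one shift [t] serves for every [x]. *)
move=> b0; set w := a - _ => w0.
have bb : edot b b != 0 by rewrite edot_eq0.
have bw : edot b w = 0 by rewrite /w !edotE (edotC b a); field.
have aw : 0 < edot a w.
  have -> : edot a w = edot w w; last by rewrite edot_gt0.
  by rewrite {2}/w edotDl edotNl edotZl bw mulr0 subr0.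
(* The shift moves the product with [u] by [2 * enorm u + 1], more than the width [2 * enorm u]. *)
have disj M v u t : 0 < edot v u -> t = (2 * enorm u + 1) / edot v u ->
    (forall x, M x -> `|edot x u| <= enorm u) -> forall x, M x -> ~ M (x + t *: v).
  move=> vu tE Mu x Mx /Mu; have := Mu x Mx.
  rewrite edotDl edotZl tE divfK ?gt_eqF// !ler_norml => /andP[h1 h2] /andP[h3 h4].
  by have := enorm_ge0 u; lra.
have Bu u x : B 1 x -> `|edot x u| <= enorm u.
  rewrite /eball /= subr0 => x1; rewrite ler_norml lerNl -edotNl.
  have h y : enorm y <= 1 -> edot y u <= enorm u.
    by move=> y1; rewrite (le_trans (cauchy_schwarz _ _))// ler_piMl ?enorm_ge0.
  by rewrite !h// enormN.
have tpos (u v : V) : 0 < edot v u -> 0 < (2 * enorm u + 1) / edot v u.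
  by move=> ?; rewrite divr_gt0// ltr_wpDl ?mulr_ge0 ?enorm_ge0.
set C := _ - slope a (B 1).
pose t := (2 * enorm w + 1) / edot a w.
have t0 : 0 < t by exact: tpos.
have v0 : 0 < volr (B 1) by apply: volr_gt0 => //; exact: subset_refl.
have Ab : 0 < slope b (B 1).
  have bb0 : 0 < edot b b by rewrite edot_gt0.
  have := @slope_ge (B 1) b _ (@cB 1) (@vB 1) (tpos _ _ bb0).
  move=> /(_ (disj _ _ _ _ bb0 erefl (Bu b))) h.
  by rewrite -(pmulr_rgt0 _ (tpos _ _ bb0)) (lt_le_trans v0).
have key x : 0 <= x -> volr (B 1) + x * slope b (B 1) <= t * (slope a (B 1) + x * C).
  move=> x0; rewrite -volr_seg// -slope_seg//.
  apply: slope_ge => //; [exact: cS|exact: vS|].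
  apply: (disj _ _ _ _ aw erefl) => _ [y [_ [By [[s [_ _ ->]] ->]]]].
  by rewrite edotDl !edotZl bw !mulr0 addr0; exact: Bu.
rewrite -(pmulr_rgt0 _ t0) ltNge; apply/negP => tC.
pose x := (t * `|slope a (B 1)|) / slope b (B 1).
have x0 : 0 <= x by exact: divr_ge0 (mulr_ge0 (ltW t0) (normr_ge0 _)) (ltW Ab).
have := key x x0; rewrite [X in _ <= X]mulrDr.
have -> : x * slope b (B 1) = t * `|slope a (B 1)| by rewrite divfK ?gt_eqF.
have : t * slope a (B 1) <= t * `|slope a (B 1)| by rewrite (ler_wpM2l (ltW t0))// ler_norm.
have : t * (x * C) <= 0 by rewrite mulrCA mulr_ge0_le0.
lra.
Qed.

Let eball_scale s : 0 < s -> (fun x => 0 + s *: x) @` B 1 = B s.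
Proof.
move=> s0; have := @scale_eball R n.+1 s 1 (ltW s0) ler01; rewrite mulr1 => <-.
apply/seteqP; split => [_ [x Bx <-]|_ [x [Bx ->]]]; first by exists x; rewrite add0r.
by exists x => //; rewrite add0r.
Qed.

Let mink_scale s M v : 0 < s ->
  (fun x => 0 + s *: x) @` minkowski_sum M (seg (s^-1 *: v)) =
  minkowski_sum ((fun x => 0 + s *: x) @` M) (seg v).
Proof.
move=> s0; have s1 : s != 0 by rewrite gt_eqF.
apply/seteqP; split.
  move=> _ [_ [x [_ [Mx [[t [t0 t1 ->]] ->]]]] <-].
  exists (0 + s *: x), (t *: v); split; first by exists x.
  split; first by exists t.
  by rewrite !add0r scalerDr !scalerA mulrAC divff// mul1r.
move=> _ [_ [_ [[x Mx <-] [[t [t0 t1 ->]] ->]]]].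
exists (x + t *: (s^-1 *: v)).
  by exists x, (t *: (s^-1 *: v)); split => //; split => //; exists t.
by rewrite !add0r scalerDr !scalerA mulrAC divff// mul1r.
Qed.

Lemma volr_seg_ball a : exists c0 c1 : R, forall s, 0 < s ->
  volr (minkowski_sum (B s) (seg a)) = c0 * s ^+ n.+1 + c1 * s ^+ n.
Proof.
exists (volr (B 1)), (slope a (B 1)) => s s0.
rewrite -eball_scale// -mink_scale// volr_homothety// volr_seg ?invr_ge0 1?ltW//.
rewrite -/(slope a (B 1)) exprS; field; exact: lt0r_neq0.
Qed.
(** Rescaling to the unit ball multiplies both segments by [s^-1]; the volume is then a polynomial
    of degree 2 in [s^-1] times [s ^+ n.+1], and [c2] is the mixed second difference. *)
Lemma volr_parallelogram_ball a b : (0 < n)%N -> b != 0 ->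
  a - (edot a b / edot b b) *: b != 0 ->
  exists c0 c1 c2 : R, 0 < c2 /\ forall s, 0 < s ->
    volr (minkowski_sum (minkowski_sum (B s) (seg b)) (seg a)) =
    c0 * s ^+ n.+1 + c1 * s ^+ n + c2 * s ^+ n.-1.
Proof.
move=> n0 b0 ab0.
exists (volr (B 1)), (slope a (B 1) + slope b (B 1)),
  (slope a (minkowski_sum (B 1) (seg b)) - slope a (B 1)); split.
  exact: slope_seg_gt0.
move=> s s0; have si : 0 <= s^-1 by rewrite invr_ge0 ltW.
rewrite -eball_scale// -!mink_scale// volr_homothety//.
rewrite (volr_seg a (cS (@cB 1)) (vS (@vB 1)) si) -/(slope a _).
have -> := slope_seg a b (@cB 1) (@vB 1) si.
rewrite volr_seg// -/(slope b _) -/(slope a _).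
have -> : s ^+ n = s * s ^+ n.-1 by rewrite -exprS prednK.
have -> : s ^+ n.+1 = s * (s * s ^+ n.-1) by rewrite -!exprS prednK.
field; exact: lt0r_neq0.
Qed.
End Parallelogram.

(** * Rolling balls *)

(* At the first maximum of [f] minus its chord, the local affine minorant would
   force the maximum to be attained earlier. *)
Lemma local_support_chord (R : realType) (f : R -> R) (a : R) : continuous f ->
  (forall t, 0 < t -> t < 1 -> exists b d : R, 0 < d /\
    forall s, `|s - t| < d -> f t + b * (s - t) <= f s) ->
  (exists2 d : R, 0 < d & forall s, `|s| < d -> f 0 + a * s <= f s) ->
  f 0 + a <= f 1.
Proof.
move=> cf supp [d d0 supp0]; rewrite leNgt; apply/negP => fa.
pose g t := f t - f 0 - t * (f 1 - f 0).
have cg : continuous g.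
  move=> t; apply: cvgB; first by apply: cvgB; [exact: cf|exact: cvg_cst].
  by apply: cvgM; [exact: cvg_id|exact: cvg_cst].
have g0 : g 0 = 0 by rewrite /g; ring.
have g1 : g 1 = 0 by rewrite /g; ring.
have [c c01 cmax] := @EVT_max R g 0 1 ler01 (continuous_subspaceT cg).
have M0 : 0 < g c.
  pose s := Num.min 1 (d / 2).
  have s0 : 0 < s by rewrite lt_min ltr01 divr_gt0.
  have s1 : s <= 1 by rewrite ge_min lexx.
  have sd : s <= d / 2 by rewrite ge_min lexx orbT.
  apply: lt_le_trans (cmax s _); last by rewrite in_itv /= (ltW s0).
  have := supp0 s; rewrite gtr0_norm// => /(_ _)/wrap[|]; first by lra.
  rewrite /g; nra.
pose S : set R := [set t | g c <= g t] `&` `[0, 1]%classic.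
have clS : closed S.
  apply: closedI; last exact: interval_closed.
  rewrite (_ : [set t | g c <= g t] = g @^-1` [set x | g c <= x])//.
  by apply: closed_comp; [move=> x _; exact: cg|exact: closed_ge].
have cS : compact S.
  exact: (subclosed_compact clS (@segment_compact R 0 1) (@subIsetr _ _ _)).
have S0 : S !=set0 by exists c; split => //=.
(* [t0] is the first point where [g] attains its maximum. *)
have [t0 + t0min] := @compact_EVT_min _ R id S S0 cS (continuous_subspaceT (fun x => @cvg_id _ _)).
rewrite inE => -[/= gt0]; rewrite in_itv /= => /andP[t00 t01].
have gt0E : g t0 = g c by apply/eqP; rewrite eq_le gt0 andbT cmax// in_itv /= t00.
have t0p : 0 < t0 by rewrite lt_def t00 andbT; apply: contraTneq gt0 => ->; rewrite g0 -ltNge.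
have t0l : t0 < 1 by rewrite lt_def t01 andbT; apply: contraTneq gt0 => <-; rewrite g1 -ltNge.
have [b [e [e0 be]]] := supp _ t0p t0l.
pose b' := b - (f 1 - f 0).
have gb s : `|s - t0| < e -> g t0 + b' * (s - t0) <= g s.
  by move=> /be; rewrite /g /b'; lra.
(* A positive slope would raise [g] above its maximum to the right of [t0]; a slope at most zero
   makes [g] maximal to the left as well. *)
have bneg : b' <= 0.
  pose s := Num.min 1 (t0 + e / 2).
  have s0 : t0 < s by rewrite lt_min t0l ltrDl divr_gt0.
  have s1 : s <= 1 by rewrite ge_min lexx.
  have se : s <= t0 + e / 2 by rewrite ge_min lexx orbT.
  have := gb s; rewrite gtr0_norm ?subr_gt0// => /(_ _)/wrap[|]; first by lra.
  have := cmax s; rewrite in_itv /= s1 (ltW (lt_trans t0p s0)) => /(_ isT).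
  rewrite gt0E => h1 h2; rewrite leNgt; apply/negP => bp; nra.
pose s := Num.max 0 (t0 - e / 2).
have s0 : 0 <= s by rewrite le_max lexx.
have st : s < t0 by rewrite gt_max t0p /= ltrBlDr ltrDl divr_gt0.
have se : t0 - e / 2 <= s by rewrite le_max lexx orbT.
have gs : g c <= g s.
  rewrite -gt0E; have := gb s; rewrite ltr0_norm ?subr_lt0// => /(_ _)/wrap[|]; first by lra.
  by move=> h; nra.
have := t0min s; rewrite inE => /(_ _)/wrap[|]; last by rewrite leNgt st.
by split => //=; rewrite in_itv /= s0 (le_trans (ltW st)).
Qed.

Section Rolling.
Variables (R : realType) (n : nat).
Local Notation V := 'rV[R]_n.+1.
Implicit Types (u v w x y p c : V).

Lemma open_enorm (U : set V) p : open U -> U p ->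
  exists2 e : R, 0 < e & forall x, enorm (x - p) < e -> U x.
Proof.
move=> oU Up; have [e /= e0 eU] := (nbhs_ballP p U).1 (open_nbhs_nbhs (conj oU Up)).
exists e => // x xe; apply: eU; split => // i j; rewrite ord1 /ball /=.
rewrite distrC (_ : x 0 j - p 0 j = (x - p) 0 j) ?(le_lt_trans (coord_le_enorm _ _))//.
by rewrite !mxE.
Qed.

(** The equality case of the Cauchy-Schwarz inequality. *)
Lemma edot_eq_enorm u v : v != 0 -> enorm u * enorm v <= edot u v ->
  u = (enorm u / enorm v) *: v.
Proof.
move=> v0 uv; have vp : 0 < enorm v by rewrite enorm_gt0.
apply/eqP; rewrite -subr_eq0 -edot_eq0 eq_le edot_ge0 andbT.
rewrite !edotE (edotC v u) -!sqr_enorm.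
set a := enorm u in uv *; set b := enorm v in vp uv *.
rewrite [leLHS](_ : _ = 2 * (a / b) * (a * b - edot u v)); last by field; exact: lt0r_neq0.
by rewrite mulr_ge0_le0 ?subr_le0// mulr_ge0// divr_ge0 ?enorm_ge0.
Qed.

Lemma unit_vector_dist v w : v != 0 -> w != 0 ->
  enorm ((enorm v)^-1 *: v - (enorm w)^-1 *: w) <= 2 * enorm (v - w) / enorm w.
Proof.
move=> v0 w0; have vp : 0 < enorm v by rewrite enorm_gt0.
have wp : 0 < enorm w by rewrite enorm_gt0.
have -> : (enorm v)^-1 *: v - (enorm w)^-1 *: w =
    (enorm w)^-1 *: (v - w) + ((enorm w - enorm v) / (enorm w * enorm v)) *: v.
  have -> : (enorm w - enorm v) / (enorm w * enorm v) = (enorm v)^-1 - (enorm w)^-1.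
    by field; rewrite !lt0r_neq0.
  by rewrite scalerBl scalerBr; apply/rowP => i; rewrite !mxE; ring.
rewrite (le_trans (enormD _ _))// !enormZ.
have h : `|enorm w - enorm v| <= enorm (v - w).
  rewrite ler_norml; have := enormD (v - w) w; have := enormD (w - v) v.
  rewrite !subrK (enormB w v); lra.
rewrite gtr0_norm ?invr_gt0// normrM [`|(_ * _)^-1|]gtr0_norm ?invr_gt0 ?mulr_gt0//.
have -> : `|enorm w - enorm v| / (enorm w * enorm v) * enorm v =
    `|enorm w - enorm v| / enorm w by field; rewrite !lt0r_neq0.
rewrite mulrC -mulrDl ler_wpM2r ?invr_ge0 ?enorm_ge0//; lra.
Qed.

(** * The set of centres of the balls contained in the body *)

Section Body.
Variables (K : set V) (r : R).
Hypotheses (n1 : (1 <= n)%N) (r0 : 0 < r) (cK : compact K) (vK : convex_set K) (K0 : K !=set0).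
Hypothesis locK : forall p, bdry K p -> exists c : V, enorm (p - c) = r /\
  exists U : set V, open U /\ U p /\ eball c r `&` U `<=` K `&` U.

Let support_point u : {p | K p /\ forall x, K x -> edot x u <= edot p u}.
Proof.
apply: cid; have [|p + pmax] := @EVT_max_rV R n.+1 (fun x => edot x u) K K0 cK.
  by apply: continuous_subspaceT; exact: edot_continuous.
by rewrite inE => Kp; exists p; split => // x Kx; apply: pmax; rewrite inE.
Qed.

Let P u : V := projT1 (support_point u).
Let PK u : K (P u). Proof. by rewrite /P; case: support_point => p []. Qed.
Let Pmax u x : K x -> edot x u <= edot (P u) u.
Proof. by rewrite /P; case: support_point => p [] /= _; apply. Qed.

Let bdry_support u : u != 0 -> bdry K (P u).
Proof.
move=> u0; split; first exact: subset_closure.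
move=> Ki; have [e e0 eK] := open_enorm (@open_interior _ K) Ki.
have up : 0 < enorm u by rewrite enorm_gt0.
pose x := P u + (e / 2 / enorm u) *: u.
have /(Pmax u) : K x.
  apply: interior_subset; apply: eK; rewrite /x addrAC subrr add0r enormZ ger0_norm.
    by rewrite divfK ?gt_eqF//; lra.
  by rewrite !divr_ge0// ltW.
rewrite /x edotDl edotZl gerDl leNgt => /negP; apply.
by rewrite mulr_gt0 ?edot_gt0// !divr_gt0.
Qed.

(** The support function of [K] minus that of the ball of radius [r]; it turns out to be the support
    function of the set of centres. *)
Let g u : R := edot (P u) u - r * enorm u.

(** Near [P w] the attached ball lies in [K], so by convexity it reaches no further than [P w] in
    the direction [w], and [P w] is its extreme point. For nearby directions the extreme points of
    the ball still lie in [K]. *)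
Let local_support w : w != 0 -> exists c, [/\ g w = edot c w,
  P w = c + (r / enorm w) *: w &
  exists2 d : R, 0 < d & forall v, enorm (v - w) < d -> edot c v <= g v].
Proof.
move=> w0; have wp : 0 < enorm w by rewrite enorm_gt0.
have [c [pc [U [oU [Up cU]]]]] := locK (bdry_support w0).
have [e e0 eU] := open_enorm oU Up.
have inb v : v != 0 -> eball c r (c + (r / enorm v) *: v).
  move=> v0; rewrite /eball /= addrAC subrr add0r enormZ ger0_norm.
    by rewrite divfK// enorm_eq0.
  by rewrite divr_ge0 ?enorm_ge0// ltW.
have inK v : eball c r v -> enorm (v - P w) < e -> K v.
  by move=> vb /eU vU; case: (cU v).
have EP : P w = c + (r / enorm w) *: w.
  pose y := c + (r / enorm w) *: w.
  pose t := Num.min 1 (e / 2 / (enorm (y - P w) + 1)).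
  have D0 : 0 < enorm (y - P w) + 1 by rewrite ltr_wpDl ?enorm_ge0.
  have t0 : 0 < t by rewrite lt_min ltr01 !divr_gt0.
  have t1 : t <= 1 by rewrite ge_min lexx.
  have tE : t * enorm (y - P w) < e.
    have : t * (enorm (y - P w) + 1) <= e / 2 by rewrite -ler_pdivlMr// ge_min lexx orbT.
    nra.
  have Kz : K ((1 - t) *: P w + t *: y).
    apply: inK; first by apply: convex_eball; rewrite ?(ltW t0)//; [rewrite /eball /= pc|exact: inb].
    have -> : (1 - t) *: P w + t *: y - P w = t *: (y - P w).
      by apply/rowP => i; rewrite !mxE; ring.
    by rewrite enormZ gtr0_norm.
  have := Pmax w Kz; rewrite edotDl !edotZl => h.
  have : edot y w <= edot (P w) w by rewrite -(ler_pM2l t0); lra.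
  rewrite /y edotDl edotZl -sqr_enorm => h1.
  rewrite -[LHS](subrK c) addrC; congr (_ + _); rewrite -[in RHS]pc; apply: edot_eq_enorm => //.
  rewrite pc edotDl edotNl.
  have : r / enorm w * enorm w ^+ 2 = r * enorm w by field; exact: lt0r_neq0.
  lra.
exists c; split => //.
  rewrite /g {1}EP edotDl edotZl -sqr_enorm; field; exact: lt0r_neq0.
(* The first bound keeps [v] away from 0, the second keeps the extreme point of the ball in the
   direction [v] within [e] of [P w]. *)
exists (Num.min (enorm w) (e * enorm w / (2 * r))).
  by rewrite lt_min wp divr_gt0 ?mulr_gt0.
move=> v; rewrite lt_min => /andP[vw1 vw2].
have v0 : v != 0.
  by apply: contraTneq vw1 => ->; rewrite add0r enormN ltxx.
have vp : 0 < enorm v by rewrite enorm_gt0.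
have Kv : K (c + (r / enorm v) *: v).
  apply: inK; first exact: inb.
  rewrite EP opprD addrACA subrr add0r -!scalerA -scalerBr enormZ gtr0_norm//.
  apply: le_lt_trans (ler_wpM2l (ltW r0) (unit_vector_dist v0 w0)) _.
  move: vw2; rewrite ltr_pdivlMr ?mulr_gt0// => h.
  by rewrite mulrA ltr_pdivrMr//; lra.
have := Pmax v Kv; rewrite edotDl edotZl -sqr_enorm /g => h.
have : r / enorm v * enorm v ^+ 2 = r * enorm v by field; exact: lt0r_neq0.
lra.
Qed.

Let g_lipschitz : exists2 k : R, 0 < k & forall u v, g u - g v <= k * enorm (u - v).
Proof.
have [k k0 Kk] := compact_sub_eball cK.
exists (k + r) => [|u v]; first exact: addr_gt0.
have h1 : edot (P u) u - edot (P v) v <= k * enorm (u - v).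
  rewrite (@le_trans _ _ (edot (P u) (u - v)))//.
    by rewrite edotDr edotNr lerB// Pmax.
  rewrite (le_trans (cauchy_schwarz _ _))// ler_wpM2r ?enorm_ge0//.
  by have := Kk _ (PK u); rewrite /eball /= subr0.
have h2 : enorm v - enorm u <= enorm (u - v).
  by have := enormD (v - u) u; rewrite subrK (enormB v u); lra.
have := ler_wpM2l (ltW r0) h2.
rewrite /g; lra.
Qed.

(** Along a segment avoiding the origin every point has a local linear minorant, so
    [local_support_chord] extends the one at [u] up to [v]. *)
Let g_support_free u v c (d : R) : u != 0 ->
  (forall t, 0 <= t -> t <= 1 -> u + t *: (v - u) != 0) ->
  g u = edot c u -> 0 < d -> (forall x, enorm (x - u) < d -> edot c x <= g x) ->
  edot c v <= g v.
Proof.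
move=> u0 path gu d0 du.
have [k k0 gk] := g_lipschitz.
pose D := enorm (v - u) + 1.
have Dp : 0 < D by rewrite ltr_wpDl ?enorm_ge0.
pose q t := u + t *: (v - u).
have qd s t : enorm (q s - q t) <= `|s - t| * D.
  rewrite /q opprD addrACA subrr add0r -scalerBl enormZ ler_wpM2l// /D.
  by rewrite lerDl.
have := @local_support_chord R (g \o q) (edot c (v - u)).
rewrite /= /q scale0r addr0 scale1r (addrC u) subrK gu edotDr edotNr (addrC (edot c u)) subrK.
apply.
- move=> t; apply/cvgrPdist_lt => e e0; near=> s.
  rewrite (@le_lt_trans _ _ (k * (`|t - s| * D)))//.
    rewrite ler_norml lerNl opprB; apply/andP; split; apply: le_trans (gk _ _) _.
      by rewrite ler_pM2l// distrC qd.
    by rewrite ler_pM2l// qd.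
  rewrite mulrCA -ltr_pdivlMr ?mulr_gt0//.
  near: s; apply/nbhs_ballP; exists (e / (k * D)) => //=.
  by rewrite divr_gt0 ?mulr_gt0.
- move=> t t0 t1; have [c' [c1 _ [e e0 ce]]] := local_support (path t (ltW t0) (ltW t1)).
  exists (edot c' (v - u)), (e / D); split => [|s st]; first by rewrite divr_gt0.
  have := ce (q s); rewrite c1 => /(_ _)/wrap[|].
    by apply: le_lt_trans (qd _ _) _; rewrite -ltr_pdivlMr.
  by apply: le_trans; rewrite /q !edotDr !edotZr !edotDr; lra.
- exists (d / D); first by rewrite divr_gt0.
  move=> s sd; have h : enorm (q s - u) < d.
    have := qd s 0; rewrite {2}/q scale0r addr0 subr0 => h; apply: le_lt_trans h _.
    by rewrite -ltr_pdivlMr.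
  apply: le_trans (du _ h); rewrite /q !edotE; lra.
Unshelve. all: by end_near.
Qed.

Let not_collinear u : exists e, forall a, e != a *: u.
Proof.
have [u0|u0] := eqVneq (u 0 ord0) 0.
  exists (delta_mx 0 ord0) => a; apply/eqP => /rowP /(_ ord0).
  by rewrite !mxE u0 mulr0 eqxx => /eqP; rewrite oner_eq0.
have j0 : (1 < n.+1)%N by [].
exists (delta_mx 0 (Ordinal j0)) => a; apply/eqP => h.
have := congr1 (fun M : V => M 0 ord0) h; rewrite !mxE => /esym/eqP.
rewrite mulf_eq0 (negPf u0) orbF => /eqP a0.
have := congr1 (fun M : V => M 0 (Ordinal j0)) h.
by rewrite !mxE a0 mul0r eqxx => /eqP; rewrite oner_eq0.
Qed.

(** If the segment from [u] to [v] meets the origin, [v] is a multiple of [u]. Moving [v] slightly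
    along a vector [e] that is no multiple of [u] frees the segment, and [g] is Lipschitz. *)
Let g_support u v c (d : R) : u != 0 ->
  g u = edot c u -> 0 < d -> (forall x, enorm (x - u) < d -> edot c x <= g x) ->
  edot c v <= g v.
Proof.
move=> u0 gu d0 du.
have [h|h] := pselect (forall t, 0 <= t -> t <= 1 -> u + t *: (v - u) != 0).
  exact: g_support_free gu d0 du.
have [e eu] := not_collinear u.
have {}h : exists a : R, v = a *: u.
  apply: contrapT => na; apply: h => t t0 t1; apply/eqP => E; apply: na.
  have [tt|tn0] := eqVneq t 0; first by move: E; rewrite tt scale0r addr0 => /eqP; rewrite (negPf u0).
  exists (1 - t^-1); rewrite scalerBl scale1r.
  have -> : v = u + t^-1 *: (t *: (v - u)) by rewrite scalerA mulVf// scale1r addrC subrK.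
  by rewrite (_ : t *: (v - u) = - u) ?scalerN//; apply/eqP; rewrite -addr_eq0 addrC E.
move: h => [a va].
have [k k0 gk] := g_lipschitz.
have ep : 0 < enorm e.
  by rewrite enorm_gt0; have := eu 0; rewrite scale0r.
have key (s : R) : 0 < s -> edot c v + s * edot c e <= g v + s * (k * enorm e).
  move=> s0; apply: (@le_trans _ _ (g (v + s *: e))).
    rewrite -edotZr -edotDr; apply: g_support_free gu d0 du => // t t0 t1.
    apply/eqP => E; have [tt|tn0] := eqVneq t 0.
      by move: E; rewrite tt scale0r addr0 => /eqP; rewrite (negPf u0).
    have := eu (- (1 + t * (a - 1)) / (t * s)); move/eqP; apply.
    have ts : t * s != 0 by rewrite mulf_neq0// gt_eqF.
    apply: (scalerI ts); rewrite scalerA mulrCA divff// mulr1.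
    apply/eqP; rewrite scaleNr -addr_eq0 -[X in _ == X]E va; apply/eqP.
    by apply/rowP => i; rewrite !mxE; ring.
  have := gk (v + s *: e) v; rewrite [v + _ - v]addrAC subrr add0r enormZ gtr0_norm//; lra.
rewrite leNgt; apply/negP => gc.
pose m := k * enorm e + `|edot c e|.
have m0 : 0 <= m by rewrite addr_ge0 ?mulr_ge0 ?enorm_ge0// ltW.
pose s := (edot c v - g v) / (2 * (m + 1)).
have s0 : 0 < s by rewrite divr_gt0 ?subr_gt0// mulr_gt0// ltr_wpDl.
have := key s s0.
have : s * (2 * (m + 1)) = edot c v - g v by rewrite divfK// gt_eqF// mulr_gt0// ltr_wpDl.
have : - `|edot c e| <= edot c e by rewrite lerNnormlW.
rewrite /m in s0 m0 *; nra.
Qed.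

(** A global linear minorant of [g] given by [c] means that the ball of radius [r] around [c] lies
    in [K]. Hence every [P u] with [u != 0] lies in the sum of [L] and the ball, and separation puts
    all of [K] there. *)
Lemma rolling_ball : exists L, [/\ compact L, convex_set L, L !=set0 &
  K = minkowski_sum L (eball 0 r)].
Proof.
pose L : set V := [set y | eball y r `<=` K].
have Lc u : u != 0 -> exists2 c, L c & P u = c + (r / enorm u) *: u.
  move=> u0; have [c [gu Pu [d d0 du]]] := local_support u0.
  exists c => // x xc; apply: contrapT => Kx.
  have [v v0 sep] := separation cK vK K0 Kx.
  have := sep _ (PK v); rewrite ltNge => /negP; apply.
  have := g_support v u0 gu d0 du; rewrite /g => h.
  rewrite -(subrK c x) edotDl.
  have := cauchy_schwarz (x - c) v.
  have : enorm (x - c) * enorm v <= r * enorm v by rewrite ler_wpM2r ?enorm_ge0.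
  lra.
have L0 : L !=set0.
  have : (delta_mx 0 ord0 : V) != 0.
    by apply/eqP => /rowP /(_ ord0); rewrite !mxE eqxx => /eqP; rewrite oner_eq0.
  by move=> /Lc[c]; exists c.
have vL : convex_set L.
  move=> x y t Lx Ly t0 t1 z zb.
  have -> : z = (1 - t) *: (x + (z - ((1 - t) *: x + t *: y))) +
      t *: (y + (z - ((1 - t) *: x + t *: y))).
    by apply/rowP => i; rewrite !mxE; ring.
  by apply: vK => //; [apply: Lx|apply: Ly]; rewrite /eball /= addrAC subrr add0r.
have cL : compact L.
  apply: (@subclosed_compact _ _ K) => //; last first.
    by move=> x; apply; apply: eball_center; exact: ltW.
  have -> : L = \bigcap_(b in eball 0 r) ((fun x => x - b) @^-1` K).
    apply/seteqP; split => [y Ly b b0 /=|y h x xy].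
      by apply: Ly; move: b0; rewrite /eball /= subr0 addrAC subrr add0r enormN.
    have := h (y - x); rewrite /= subKr; apply.
    by rewrite /eball /= subr0 enormB.
  apply: closed_bigI => b _; apply: closed_comp; last first.
    exact: compact_closed (@norm_hausdorff _ _) cK.
  by move=> x _; apply: continuousB; [exact: cvg_id|exact: cst_continuous].
exists L; split => //; apply/seteqP; split; last first.
  move=> _ [y [b [Ly [b0 ->]]]]; apply: Ly; move: b0.
  by rewrite /eball /= subr0 addrAC subrr add0r.
move=> x Kx; apply: contrapT => nx.
have cS : compact (minkowski_sum L (eball 0 r)) by apply: mink_compact => //; exact: compact_eball.
have vS : convex_set (minkowski_sum L (eball 0 r)) by apply: mink_convex => //; exact: convex_eball.
have in0 v : v != 0 -> minkowski_sum L (eball 0 r) (P v).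
  move=> v0; have [c cLc ->] := Lc v v0; exists c, ((r / enorm v) *: v); split => //.
  split => //; rewrite /eball /= subr0 enormZ ger0_norm ?divr_ge0 ?enorm_ge0 ?(ltW r0)//.
  by rewrite divfK// enorm_eq0.
have [|v v0 sep] := separation cS vS _ nx.
  have [c Lcc] := L0; exists (c + 0), c, 0; split => //.
  by split => //; apply: eball_center; exact: ltW.
by have := sep _ (in0 v v0); rewrite ltNge (Pmax v Kx).
Qed.
End Body.
End Rolling.

(** * Binomial convexity and sausage bodies *)

(** Both sides count the splittings of [N] objects into parts of sizes [i], [l - i] and [N - l]. *)
Lemma mul_bin_trinomial N l i : (i <= l)%N -> (l <= N)%N ->
  ('C(N, l) * 'C(l, i) = 'C(N, i) * 'C(N - i, N - l))%N.
Proof.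
move=> il lN; have iN := leq_trans il lN.
have Nli : (N - l <= N - i)%N by rewrite leq_sub2l.
have e : (N - i - (N - l) = l - i)%N by lia.
have h1 := bin_fact lN; have h2 := bin_fact il; have h3 := bin_fact iN.
have h4 := bin_fact Nli; rewrite e in h4.
have f0 : (0 < i`! * (l - i)`! * (N - l)`!)%N by rewrite !muln_gt0 !fact_gt0.
apply/eqP; rewrite -(eqn_pmul2r f0); apply/eqP.
transitivity N`!.
  by rewrite -h1 -h2 !mulnA; congr muln; rewrite -!mulnA.
by rewrite -h3 -h4; rewrite !mulnA; lia.
Qed.

(** By Pascal's rule the increments of ['C(_, m.+1)] are the values of ['C(_, m)], which do not
    decrease; this bounds the slopes here from below and in the next lemma from above. *)
Lemma bin_slope_ge x d m : ('C(x, m.+1) + d * 'C(x, m) <= 'C(x + d, m.+1))%N.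
Proof.
elim: d => [|d IH]; first by rewrite mul0n !addn0.
have := leq_bin2l m (leq_addr d x); rewrite addnS binS mulSn; lia.
Qed.

Lemma bin_slope_le x d m :
  ('C(x + d.+1, m.+1) <= 'C(x, m.+1) + d.+1 * 'C(x + d, m))%N.
Proof.
elim: d => [|d IH]; first by rewrite addn1 addn0 binS mul1n.
have h : ('C(x + d, m) <= 'C(x + d.+1, m))%N by rewrite leq_bin2l// leq_add2l.
have := leq_mul (leqnn d.+1) h; rewrite [(x + d.+2)%N]addnS binS [(d.+2 * _)%N]mulSn; lia.
Qed.

Section BinomialConvexity.
Variable R : realFieldType.

(** When [x], [y], [z] are the complements of [k], [j], [i] in a fixed number, this is [k - i] times
    the height of the chord of ['C(_, m)] from [x] to [z] above its value at [y]. *)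
Definition bin_chord (i j k : R) (x y z m : nat) : R :=
  (k - j) * 'C(z, m)%:R + (i - k) * 'C(y, m)%:R + (j - i) * 'C(x, m)%:R.

Lemma bin_convex (i j k N m : nat) : (i < j)%N -> (j < k)%N -> (k <= N)%N ->
  [/\ 0 <= bin_chord i%:R j%:R k%:R (N - k) (N - j) (N - i) m,
    (m <= 1)%N -> bin_chord i%:R j%:R k%:R (N - k) (N - j) (N - i) m = 0 &
    m = 2%N -> 0 < bin_chord i%:R j%:R k%:R (N - k) (N - j) (N - i) m].
Proof.
move=> ij jk kN.
set x := (N - k)%N; pose d := (k - j.+1)%N; pose e := (j - i)%N.
have -> : (N - j = x + d.+1)%N by rewrite /x /d; lia.
have -> : (N - i = x + d.+1 + e)%N by rewrite /x /d /e; lia.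
have Ek : k%:R = j%:R + d.+1%:R :> R by rewrite -natrD; congr _%:R; rewrite /d; lia.
have Ej : j%:R = i%:R + e%:R :> R by rewrite -natrD; congr _%:R; rewrite /e; lia.
have e0 : 0 < e%:R :> R by rewrite ltr0n /e subn_gt0.
have d0 : 0 < d.+1%:R :> R by rewrite ltr0n.
(* The slope after the middle point is at least ['C(x + d.+1, m')], the slope before it at most
   ['C(x + d, m')]; for [m' = 1] these differ by 1. *)
have key m' : d.+1%:R * e%:R * ('C(x + d.+1, m')%:R - 'C(x + d, m')%:R) <=
    bin_chord i%:R j%:R k%:R x (x + d.+1) (x + d.+1 + e) m'.+1.
  have := bin_slope_ge (x + d.+1) e m'; rewrite -(ler_nat R) natrD natrM.
  have := bin_slope_le x d m'; rewrite -(ler_nat R) natrD natrM.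
  move=> /(ler_wpM2l (ltW e0)) h1 /(ler_wpM2l (ltW d0)) h2.
  rewrite /bin_chord Ek Ej; lra.
have chord01 m' : (m' <= 1)%N -> bin_chord i%:R j%:R k%:R x (x + d.+1) (x + d.+1 + e) m' = 0.
  case: m' => [|[|//]] _; rewrite /bin_chord ?bin0 ?bin1 ?natrD Ek Ej; ring.
split; [|exact: chord01|move=> m2]; last first.
  rewrite m2; apply: lt_le_trans (key 1%N).
  by rewrite !bin1 addnS -[(x + d).+1]addn1 [X in X - _]natrD addrAC subrr add0r mulr1 mulr_gt0.
case: m => [|m]; first by rewrite chord01.
apply: le_trans (key m); rewrite mulr_ge0 ?mulr_ge0 ?(ltW e0) ?(ltW d0)//.
by rewrite subr_ge0 ler_nat leq_bin2l// leq_add2l.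
Qed.

End BinomialConvexity.

(** * Shifting the Steiner polynomial *)

Section SteinerPolynomial.
Variables (R : realType) (n : nat).

Lemma coef_XaddC_exp (r : R) l i : (('X + r%:P) ^+ l)`_i = 'C(l, i)%:R * r ^+ (l - i).
Proof.
rewrite addrC exprDn coef_sum.
under eq_bigr => j _ do rewrite coefMn -rmorphXn /= coefCM coefXn.
have [il|li] := ltnP i l.+1.
  rewrite (bigD1 (Ordinal il))//= eqxx mulr1 big1 ?addr0 ?mulr_natl// => j.
  by rewrite eq_sym -val_eqE /= => /negPf ->; rewrite mulr0 mul0rn.
rewrite bin_small// mul0r big1// => j _.
by rewrite gtn_eqF ?mulr0 ?mul0rn// (leq_trans (ltn_ord j)).
Qed.

(** Expanding the shifted powers produces ['C(l, i)]; the trinomial identity trades it for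
    ['C(n.+1 - i, n.+1 - l)], so that [i] only enters as the argument [n.+1 - i] of a binomial
    function. *)
Lemma quermass_expand (W : nat -> R) (r : R) (p : {poly R}) : 0 < r ->
  (size p <= n.+2)%N ->
  (forall i, (i <= n.+1)%N -> (p \Po ('X + r%:P))`_i = 'C(n.+1, i)%:R * W i) ->
  forall i, (i <= n.+1)%N -> W i * r ^+ i =
    \sum_(l < n.+2) p`_l * r ^+ l / 'C(n.+1, l)%:R * 'C(n.+1 - i, n.+1 - l)%:R.
Proof.
move=> r0 sp pW i iN.
have C0 l : (l <= n.+1)%N -> 'C(n.+1, l)%:R != 0 :> R.
  by move=> lN; rewrite pnatr_eq0 -lt0n bin_gt0.
apply: (mulfI (C0 i iN)); rewrite mulrA -pW//.
have -> : p \Po ('X + r%:P) = \sum_(l < n.+2) p`_l *: ('X + r%:P) ^+ l.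
  have {1}-> : p = \sum_(l < n.+2) p`_l *: 'X^l.
    rewrite -poly_def; apply/polyP => l; rewrite coef_poly; case: ltnP => // lN.
    by rewrite nth_default// (leq_trans sp).
  rewrite raddf_sum /=; apply: eq_bigr => l _.
  by rewrite comp_polyZ comp_Xn_poly.
rewrite coef_sum mulr_suml mulr_sumr; apply: eq_bigr => l _.
rewrite coefZ coef_XaddC_exp.
have lN : (l <= n.+1)%N by rewrite -ltnS.
have [il|li] := leqP i l; last first.
  have Nli : (n.+1 - i < n.+1 - l)%N by lia.
  by rewrite (bin_small li) (bin_small Nli) !mulr0n !(mul0r, mulr0).
have := congr1 (fun k => k%:R : R) (mul_bin_trinomial il lN).
rewrite !natrM => E.
have -> : 'C(l, i)%:R = 'C(n.+1, i)%:R * 'C(n.+1 - i, n.+1 - l)%:R / 'C(n.+1, l)%:R :> R.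
  by rewrite -E mulrC mulKf// C0.
have -> : r ^+ l = r ^+ (l - i) * r ^+ i by rewrite -exprD subnK.
ring.
Qed.
End SteinerPolynomial.

(** * Segments, sausage bodies and inscribed parallelograms *)

Section Sausage.
Variables (R : realType) (n : nat).
Local Notation V := 'rV[R]_n.+1.
Implicit Types (c x y : V) (L : set V).

Definition lseg c1 c2 : set V :=
  [set x | exists t, [/\ 0 <= t, t <= 1 & x = (1 - t) *: c1 + t *: c2]].

Lemma lsegE c1 c2 :
  lseg c1 c2 = minkowski_sum [set 2^-1 *: (c1 + c2)] (seg (2^-1 *: (c2 - c1))).
Proof.
rewrite mink1; apply/seteqP; split.
  move=> _ [t [t0 t1 ->]]; exists ((2 * t - 1) *: (2^-1 *: (c2 - c1))).
    by exists (2 * t - 1); split; [lra|lra|].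
  by apply/rowP => i; rewrite !mxE; field.
move=> _ [_ [t [t0 t1 ->]] <-]; exists ((t + 1) / 2); split; [lra|lra|].
by apply/rowP => i; rewrite !mxE; field.
Qed.

Lemma lseg_compact c1 c2 : compact (lseg c1 c2).
Proof. by rewrite lsegE; apply: mink_compact; [exact: compact_set1|exact: seg_compact]. Qed.

Lemma lseg_convex c1 c2 : convex_set (lseg c1 c2).
Proof.
rewrite lsegE; apply: mink_convex; last exact: seg_convex.
by move=> _ _ t -> -> _ _ /=; rewrite -scalerDl subrK scale1r.
Qed.

Lemma sausage_hull c1 c2 (r : R) : 0 <= r ->
  conv_hull (eball c1 r `|` eball c2 r) = minkowski_sum (lseg c1 c2) (eball 0 r).
Proof.
move=> r0; apply/seteqP; split.
  move=> x; apply; first by apply: mink_convex; [exact: lseg_convex|exact: convex_eball].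
  have sub c : lseg c1 c2 c -> eball c r `<=` minkowski_sum (lseg c1 c2) (eball 0 r).
    move=> cl y yc; exists c, (y - c); split => //.
    by split; [rewrite /eball /= subr0|rewrite addrC subrK].
  move=> y [|]; apply: sub.
    by exists 0; split=> //; rewrite subr0 scale1r scale0r addr0.
  by exists 1; split=> //; rewrite subrr scale1r scale0r add0r.
move=> _ [_ [b [[t [t0 t1 ->]] [br ->]]]] C vC sC.
have -> : (1 - t) *: c1 + t *: c2 + b = (1 - t) *: (c1 + b) + t *: (c2 + b).
  by apply/rowP => i; rewrite !mxE; ring.
by apply: vC => //; apply: sC; [left|right]; move: br;
  rewrite /eball /= subr0 addrAC subrr add0r.
Qed.

(** The end points are where the product with a direction vector of the line is smallest and
    largest. *)
Lemma collinear_lseg L : compact L -> convex_set L -> L !=set0 ->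
  (forall x y z, L x -> L y -> L z -> y != x -> exists t : R, z = x + t *: (y - x)) ->
  exists c1 c2, L = lseg c1 c2.
Proof.
move=> cL vL L0 col; have [x0 Lx0] := L0.
have sub a b : L a -> L b -> lseg a b `<=` L.
  by move=> La Lb _ [t [t0 t1 ->]]; exact: vL.
have [[x1 [Lx1 x10]]|h] := pselect (exists y, L y /\ y != x0); last first.
  exists x0, x0; apply/seteqP; split; last exact: sub.
  move=> y Ly; exists 0; split => //; rewrite subr0 scale1r scale0r addr0.
  by apply: contrapT => yx; apply: h; exists y; split => //; apply/eqP.
pose d := x1 - x0.
have dd : 0 < edot d d by rewrite edot_gt0 subr_eq0.
have cd : {within L, continuous (fun x : V => edot x d)}.
  by apply: continuous_subspaceT; exact: edot_continuous.
have [a + amin] := EVT_min_rV L0 cL cd; have [b + bmax] := EVT_max_rV L0 cL cd.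
rewrite !inE => Lb La; exists a, b; apply/seteqP; split; last exact: sub.
move=> x Lx; have [s sE] := col _ _ _ Lx0 Lx1 La x10.
have [t tE] := col _ _ _ Lx0 Lx1 Lb x10; have [u uE] := col _ _ _ Lx0 Lx1 Lx x10.
have su : s <= u.
  have := amin x; rewrite inE => /(_ Lx); rewrite sE uE !edotDl !edotZl -/d lerD2l.
  by rewrite ler_pM2r.
have ut : u <= t.
  have := bmax x; rewrite inE => /(_ Lx); rewrite tE uE !edotDl !edotZl -/d lerD2l.
  by rewrite ler_pM2r.
have [st|st] := eqVneq s t.
  have -> : x = a by rewrite uE sE (_ : u = s)//; lra.
  by exists 0; split => //; rewrite subr0 scale1r scale0r addr0.
have st0 : 0 < t - s by rewrite subr_gt0 lt_neqAle st (le_trans su).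
exists ((u - s) / (t - s)); split.
- by rewrite divr_ge0 ?subr_ge0// (le_trans su).
- by rewrite ler_pdivrMr// mul1r lerB.
rewrite uE sE tE; apply/rowP => i; rewrite !mxE; field; exact: lt0r_neq0.
Qed.

(** The factors 1/4 give the parallelogram with one vertex at [x], the opposite one at the midpoint
    of [y] and [z], and the others at the midpoints of the sides at [x]. *)
Lemma parallelogram_sub L x y z : convex_set L -> L x -> L y -> L z ->
  minkowski_sum [set x + 4^-1 *: ((y - x) + (z - x))]
    (minkowski_sum (seg (4^-1 *: (y - x))) (seg (4^-1 *: (z - x)))) `<=` L.
Proof.
move=> vL Lx Ly Lz _ [_ [_ [-> [[_ [_ [[s [s0 s1 ->]] [[t [t0 t1 ->]] ->]]]] ->]]]].
pose a := (1 + s) / 4; pose b := (1 + t) / 4.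
have a0 : 0 <= a by rewrite /a; lra.
have b0 : 0 <= b by rewrite /b; lra.
have ab : a + b <= 1 by rewrite /a /b; lra.
have [ab0|ab0] := eqVneq (a + b) 0.
  rewrite (_ : _ + _ = x)//; apply/rowP => i; rewrite !mxE.
  have -> : s = -1 by move: a0 b0 ab0; rewrite /a /b; lra.
  have -> : t = -1 by move: a0 b0 ab0; rewrite /a /b; lra.
  by field.
have abp : 0 < a + b by rewrite lt_def ab0 addr_ge0.
rewrite (_ : _ + _ = (1 - (a + b)) *: x +
    (a + b) *: ((1 - b / (a + b)) *: y + (b / (a + b)) *: z)).
  apply: (vL) => //; last exact: ltW.
  apply: vL => //; first exact: divr_ge0 b0 (ltW abp).
  by rewrite ler_pdivrMr// mul1r lerDr.
apply/rowP => i; rewrite !mxE.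
have -> : (a + b) * ((1 - b / (a + b)) * y 0 i + b / (a + b) * z 0 i) = a * y 0 i + b * z 0 i.
  by field.
by rewrite /a /b; field.
Qed.

End Sausage.

(** * Quermassintegrals *)

Section QuermassPolynomial.
Variables (R : realType) (n : nat) (W : nat -> R) (r : R) (K : set 'rV[R]_n.+1).
Hypotheses (r0 : 0 < r) (qK : quermass K W).

(* The Steiner formula of [K = L + rB] only describes [vol (L + sB)] for [s >= r]. *)
Definition outer_steiner : {poly R} :=
  (\poly_(i < n.+2) ('C(n.+1, i)%:R * W i)) \Po ('X - r%:P).

Local Notation p := outer_steiner.

Lemma size_outer_steiner : (size p <= n.+2)%N.
Proof. by rewrite size_comp_poly2 ?size_XsubC// size_poly. Qed.

Lemma volr_outer_steiner L s : compact L -> K = minkowski_sum L (eball 0 r) -> r <= s ->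
  volr (minkowski_sum L (eball 0 s)) = p.[s].
Proof.
move=> cL KE rs; have sr : 0 <= s - r by rewrite subr_ge0.
have := qK sr; rewrite scale_eball// mulr1 KE -minkA mink_eballD ?(ltW r0)// addr0.
rewrite addrC subrK /volr => -> /=.
by rewrite horner_comp !hornerE horner_poly.
Qed.

(** Comparison with the empty set, a compact convex subset of [L] with zero Steiner polynomial. *)
Lemma outer_steiner_ge0 L i : compact L -> convex_set L ->
  K = minkowski_sum L (eball 0 r) -> 0 <= p`_i.
Proof.
move=> cL vL KE; suff : (0 : {poly R})`_i <= p`_i by rewrite coef0.
apply: (@steiner_coef_le R n L set0 p 0 r) => //.
- exact: compact0.
- exact: ltW.
- exact: size_outer_steiner.
- by rewrite size_poly0.
- by move=> s; exact: volr_outer_steiner.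
move=> s _; rewrite horner0 (_ : minkowski_sum _ _ = set0) ?volr_set0//.
by rewrite -subset0 => z [x [y []]].
Qed.

(** The segment is compared with itself: [p] and the explicit [q] describe the same volumes, so the
    coefficients of [p] are at most those of [q], which vanish below degree [n]. *)
Lemma outer_steiner_lseg c1 c2 l : K = minkowski_sum (lseg c1 c2) (eball 0 r) ->
  (l < n)%N -> p`_l = 0.
Proof.
move=> KE ln; have [a0 [a1 aE]] := @volr_seg_ball R n (2^-1 *: (c2 - c1)).
pose q : {poly R} := a0 *: 'X^(n.+1) + a1 *: 'X^n.
have qE s : r <= s -> volr (minkowski_sum (lseg c1 c2) (eball 0 s)) = q.[s].
  move=> rs; rewrite lsegE -minkA mink1 volr_translate minkC aE ?(lt_le_trans r0)//.
  by rewrite /q !hornerE.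
have sq : (size q <= n.+2)%N.
  apply/leq_sizeP => j nj; rewrite !coefE (gtn_eqF nj) (gtn_eqF (leq_trans _ nj))//.
  by rewrite !mulr0 addr0.
have cL := @lseg_compact _ _ c1 c2; have vL := @lseg_convex _ _ c1 c2.
have pE s (rs : r <= s) := volr_outer_steiner cL KE rs.
have ql : q`_l = 0 by rewrite !coefE !ltn_eqF ?mulr0 ?addr0// ltnW.
apply/eqP; rewrite eq_le (outer_steiner_ge0 _ cL vL KE) andbT.
have := steiner_coef_le cL vL cL vL (@subset_refl _ _) (ltW r0) sq size_outer_steiner qE pE l.
by rewrite ql.
Qed.

(** Three points of [L] off a line would give a parallelogram inside [L], whose polynomial has a
    positive coefficient of degree [n.-1]; by monotonicity that of [p] would be positive too. *)
Lemma outer_steiner_collinear L : (0 < n)%N -> compact L -> convex_set L ->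
  K = minkowski_sum L (eball 0 r) -> p`_n.-1 = 0 ->
  forall x y z, L x -> L y -> L z -> y != x -> exists t : R, z = x + t *: (y - x).
Proof.
move=> n0 cL vL KE pn x y z Lx Ly Lz yx.
set b := y - x; pose a := z - x.
have b0 : b != 0 by rewrite subr_eq0.
exists (edot a b / edot b b); apply/eqP; rewrite addrC -subr_eq -/a -subr_eq0.
apply/negPn/negP => ab0.
have bb : edot b b != 0 by rewrite edot_eq0.
have b'0 : 4^-1 *: b != 0 by rewrite scaler_eq0 negb_or b0 invr_eq0 pnatr_eq0.
have a'0 : 4^-1 *: a - (edot (4^-1 *: a) (4^-1 *: b) / edot (4^-1 *: b) (4^-1 *: b)) *: (4^-1 *: b) != 0.
  have -> : edot (4^-1 *: a) (4^-1 *: b) / edot (4^-1 *: b) (4^-1 *: b) = edot a b / edot b b.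
    by move: a b bb {b0 ab0 b'0} => u v vv; rewrite !edotE; field.
  by rewrite scalerA mulrC -scalerA -scalerBr scaler_eq0 negb_or ab0 invr_eq0 pnatr_eq0.
have [c0 [c1 [c2 [c20 cE]]]] := volr_parallelogram_ball n0 b'0 a'0.
pose q : {poly R} := c0 *: 'X^(n.+1) + c1 *: 'X^n + c2 *: 'X^(n.-1).
have sq : (size q <= n.+2)%N.
  apply/leq_sizeP => j nj; rewrite !coefE.
  by rewrite !gtn_eqF ?mulr0 ?addr0//; lia.
have qE s : r <= s -> volr (minkowski_sum (minkowski_sum [set x + 4^-1 *: (b + a)]
    (minkowski_sum (seg (4^-1 *: b)) (seg (4^-1 *: a)))) (eball 0 s)) = q.[s].
  move=> rs; rewrite -minkA mink1 volr_translate minkC minkA cE ?(lt_le_trans r0)//.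
  by rewrite /q !hornerE.
have cM : compact (minkowski_sum [set x + 4^-1 *: (b + a)]
    (minkowski_sum (seg (4^-1 *: b)) (seg (4^-1 *: a)))).
  apply: mink_compact; first exact: compact_set1.
  by apply: mink_compact; exact: seg_compact.
have vM : convex_set (minkowski_sum [set x + 4^-1 *: (b + a)]
    (minkowski_sum (seg (4^-1 *: b)) (seg (4^-1 *: a)))).
  apply: mink_convex; last by apply: mink_convex; exact: seg_convex.
  by move=> _ _ t -> -> _ _ /=; rewrite -scalerDl subrK scale1r.
have pE s (rs : r <= s) := volr_outer_steiner cL KE rs.
have := steiner_coef_le cL vL cM vM (parallelogram_sub vL Lx Ly Lz) (ltW r0)
  size_outer_steiner sq pE qE n.-1.
rewrite pn !coefE eqxx mulr1 !ltn_eqF; [|lia|lia].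
by rewrite !mulr0 !add0r leNgt c20.
Qed.

(** This is [w_l * r ^+ l] when the coefficients of [p] are written as ['C(n.+1, l)%:R * w_l]. *)
Definition bin_weight l : R := p`_l * r ^+ l / 'C(n.+1, l)%:R.

Lemma quermass_chord i j k : (i < j)%N -> (j < k)%N -> (k <= n.+1)%N ->
  (k%:R - j%:R) * (W i * r ^+ i) + (i%:R - k%:R) * (W j * r ^+ j) +
    (j%:R - i%:R) * (W k * r ^+ k) =
  \sum_(l < n.+2) bin_weight l *
    bin_chord i%:R j%:R k%:R (n.+1 - k) (n.+1 - j) (n.+1 - i) (n.+1 - l).
Proof.
move=> ij jk kN; have jN := leq_trans (ltnW jk) kN; have iN := leq_trans (ltnW ij) jN.
have pW l : (l <= n.+1)%N -> (p \Po ('X + r%:P))`_l = 'C(n.+1, l)%:R * W l.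
  move=> lN; rewrite -comp_polyA comp_polyB comp_polyX comp_polyC addrK comp_polyXr.
  by rewrite coef_poly ltnS lN.
rewrite !(quermass_expand r0 size_outer_steiner pW)//.
rewrite !mulr_sumr -!big_split /=; apply: eq_bigr => l _.
rewrite /bin_chord /bin_weight; ring.
Qed.

Lemma bin_weight_ge0 L l : compact L -> convex_set L ->
  K = minkowski_sum L (eball 0 r) -> 0 <= bin_weight l.
Proof.
move=> cL vL KE; rewrite divr_ge0// mulr_ge0 ?exprn_ge0 ?(ltW r0)//.
exact: outer_steiner_ge0 KE.
Qed.

End QuermassPolynomial.

(** * The inequality and its equality case *)

Theorem theoremA (R : realType) (n : nat) (lam : R) (K : set 'rV[R]_(n.+1))
    (W : nat -> R) :
  (1 <= n)%N -> 0 < lam -> convex_body K -> lambda_concave lam K ->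
  quermass K W ->
  forall i j k : nat, (i < j)%N -> (j < k)%N -> (k <= n.+1)%N ->
    let Q := (k%:R - j%:R) * (W i / lam ^+ i) + (i%:R - k%:R) * (W j / lam ^+ j)
             + (j%:R - i%:R) * (W k / lam ^+ k) in
    0 <= Q /\ (Q = 0 <-> lambda_sausage lam K).
Proof.
move=> n1 lam0 [cK [vK Ki]] concK qK i j k ij jk kN.
rewrite -!exprVn; set r := lam^-1.
have r0 : 0 < r by rewrite invr_gt0.
have K0 : K !=set0 by case: Ki => x /interior_subset; exists x.
have [L [cL vL L0 KL]] := rolling_ball n1 r0 cK vK K0 concK.
rewrite (quermass_chord W r0 ij jk kN) => Q.
have chord m := @bin_convex R i j k n.+1 m ij jk kN.
have term_ge0 (l : 'I_n.+2) : 0 <= bin_weight n W r l *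
    bin_chord i%:R j%:R k%:R (n.+1 - k) (n.+1 - j) (n.+1 - i) (n.+1 - l).
  by rewrite mulr_ge0 ?(bin_weight_ge0 r0 qK l cL vL KL)//; case: (chord (n.+1 - l)%N).
split; first exact: sumr_ge0.
split => [/eqP|[c1 [c2 KE]]].
  (* The term with [l = n.-1] has a positive binomial factor, so a zero sum makes that coefficient
     vanish. *)
  have ln : (n.-1 < n.+2)%N by lia.
  rewrite psumr_eq0// => /allP /(_ (Ordinal ln)); rewrite mem_index_enum => /(_ isT) /=.
  have -> : (n.+1 - n.-1 = 2)%N by lia.
  have [_ _ /(_ erefl) c0] := chord 2%N.
  rewrite mulf_eq0 (gt_eqF c0) orbF mulf_eq0 invr_eq0 pnatr_eq0 -leqn0 leqNgt bin_gt0.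
  rewrite (leq_trans (leq_pred n))//= orbF mulf_eq0 expf_eq0 (gt_eqF r0) andbF orbF.
  move=> /eqP /(outer_steiner_collinear r0 qK n1 cL vL KL) col.
  have [c1 [c2 LE]] := collinear_lseg cL vL L0 col.
  by exists c1, c2; rewrite KL LE sausage_hull// ltW.
apply: big1 => l _; rewrite (sausage_hull _ _ (ltW r0)) in KE.
(* For [l < n] the weight of a sausage body vanishes; for [l >= n] the binomial function has degree
   at most one and coincides with its chord. *)
have [ln|nl] := ltnP l n.
  by rewrite /bin_weight (outer_steiner_lseg r0 qK KE ln) !mul0r.
have [_ chord0 _] := chord (n.+1 - l)%N.
by rewrite chord0 ?mulr0//; lia.
Qed.
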